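(* Let $\{\epsilon_t\}_{t\in\mathbb{Z}}$ be iid regularly varying random variables with tail index $\alpha>0$ and extremal skewness coefficient $p_\epsilon$, with $\mathbb{E}\epsilon_t=0$ if $\alpha>1$. Let $a=\{a_j\}_{j\ge0}\in\mathcal{C}_\alpha$ and $Y_t=\sum_{j=0}^\infty a_j\epsilon_{t-j}$, $t\in\mathbb{Z}$, and suppose $\{Y_t\}$ is invertible: there is a real sequence $\{b_j\}$ with $\epsilon_t=\sum_{j\ge0}b_jY_{t-j}$ a.s. for all $t$. Let $h\ge1$ with $\eta_+(a,h)>0$, and let $\widehat Y_{t+h}^{\mathrm{opt}}=\sum_{j=0}^\infty a_{j+h}\epsilon_{t-j}$. Then the extremal optimal precision for prediction of $\mathbb{I}(Y_{t+h}>y_0)$ is \[ \lambda_h^{(\mathrm{opt})}:=\lambda(Y_{t+h},\widehat Y_{t+h}^{\mathrm{opt}})=\frac{\eta_+(a,h)}{\eta_+(a,0)}. \]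
   Context: A random variable $X$ is regularly varying with tail index $\alpha>0$ and extremal skewness $p_X\in[0,1]$ if $x\mapsto\mathbb{P}(|X|>x)$ is regularly varying with index $-\alpha$ and $\mathbb{P}(X>x)/\mathbb{P}(|X|>x)\to p_X$. $\mathcal{C}_\alpha$ is the set of real sequences $\{b_j\}$ with $\sum_j|b_j|^\delta<\infty$ for some $\delta\in(0,\alpha)\cap(0,2]$. $\kappa_+(b_j)=p_\epsilon\mathbb{I}(b_j>0)+(1-p_\epsilon)\mathbb{I}(b_j<0)$ and $\eta_+(b,h)=\sum_{j=h}^\infty\kappa_+(b_j)|b_j|^\alpha$. With $F_\xi^{\leftarrow}(p)=\inf\{y:F_\xi(y)\ge p\}$, $\lambda(\xi,\zeta)=\lim_{p\uparrow1}\mathbb{P}[\xi>F_\xi^{\leftarrow}(p)\mid\zeta>F_\zeta^{\leftarrow}(p)]$ (tail dependence coefficient). The extremal optimal precision is the limiting (as $p\uparrow1$) best precision $\mathbb{P}(Y_{t+h}>F_Y^{\leftarrow}(p)\mid W>F_W^{\leftarrow}(p))$ over predictors $W$ that are functions of $Y_s,s\le t$ calibrated so that $\mathbb{P}(W>F_W^{\leftarrow}(p))=1-p$. *)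

(* Defs.v *)
From HB Require Import structures.
From mathcomp Require Import all_boot all_order all_algebra.
From mathcomp Require Import all_classical all_reals all_analysis.
Set Implicit Arguments. Unset Strict Implicit. Unset Printing Implicit Defensive.
Import Order.TTheory GRing.Theory Num.Theory.
Import numFieldNormedType.Exports.
Local Open Scope classical_set_scope.
Local Open Scope ring_scope.

Section defs.
Context {R : realType} {d : measure_display} {T : measurableType d}.
Variable P : probability T R.

Definition abs_tail (X : T -> R) (x : R) : R := fine (P [set w | x < `|X w|]).
Definition right_tail (X : T -> R) (x : R) : R := fine (P [set w | x < X w]).

Definition regularly_varying_fun (f : R -> R) (rho : R) : Prop :=
  (\forall x \near +oo, 0 < f x) /\
  forall x : R, 0 < x -> (fun s => f (s * x) / f s) @ +oo --> x `^ rho.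

Definition regularly_varying_rv (X : T -> R) (alpha pX : R) : Prop :=
  0 < alpha /\ 0 <= pX <= 1 /\
  regularly_varying_fun (abs_tail X) (- alpha) /\
  (fun x => right_tail X x / abs_tail X x) @ +oo --> pX.

Definition iid (X : int -> T -> R) : Prop :=
  (forall t, measurable_fun setT (X t)) /\
  (forall (s : seq int) (B : int -> set R), uniq s ->
     (forall i, measurable (B i)) ->
     P (\bigcap_(i in [set` s]) (X i @^-1` B i)) =
     (\big[*%E/1%E]_(i <- s) P (X i @^-1` B i))%E) /\
  (forall t (B : set R), measurable B -> P (X t @^-1` B) = P (X 0 @^-1` B)).

Definition cdf (X : T -> R) (y : R) : R := fine (P [set w | X w <= y]).
Definition quantile (X : T -> R) (p : R) : R := inf [set y | p <= cdf X y].

Definition exceed (X : T -> R) (p : R) : set T := [set w | quantile X p < X w].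

Definition condprob (A B : set T) : R := fine (P (A `&` B)) / fine (P B).

Definition tail_dep_coeff_is (xi zeta : T -> R) (l : R) : Prop :=
  (fun p => condprob (exceed xi p) (exceed zeta p)) @ 1^'- --> l.

Definition past_sigma (Y : int -> T -> R) (t : int) : set (set T) :=
  <<s [set C | exists s (A : set R), s <= t /\ measurable A /\ C = Y s @^-1` A] >>.

Definition predictor (Y : int -> T -> R) (t : int) (W : T -> R) : Prop :=
  forall B : set R, measurable B -> past_sigma Y t (W @^-1` B).

Definition best_precision (Y : int -> T -> R) (t : int) (target : T -> R) (p : R) : R :=
  sup [set c | exists W, predictor Y t W /\ fine (P (exceed W p)) = 1 - p /\
                         c = condprob (exceed target p) (exceed W p)].

Definition extremal_optimal_precision_is (Y : int -> T -> R) (t : int)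
  (target : T -> R) (l : R) : Prop :=
  best_precision Y t target @ 1^'- --> l.

End defs.

Definition C_alpha {R : realType} (alpha : R) (b : nat -> R) : Prop :=
  exists delta : R, 0 < delta < alpha /\ delta <= 2 /\
    exists l : R, series (fun j => `|b j| `^ delta) @ \oo --> l.

Definition kappa_plus {R : realType} (pe : R) (x : R) : R :=
  if 0 < x then pe else if x < 0 then 1 - pe else 0.

Definition eta_plus {R : realType} (pe alpha : R) (b : nat -> R) (h : nat) : R :=
  limn (series (fun j => kappa_plus pe (b (j + h)%N) * `|b (j + h)%N| `^ alpha)).

(* Main.v *)
(** Write [f x = P(|eps| > x)]. A sum of independent variables whose right tails
    are asymptotic to [c1 f] and [c2 f] has right tail asymptotic to
    [(c1 + c2) f]: it is large only if exactly one summand is. This settles the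
    finite moving averages. The remainders [\sum_(j >= N) a_j eps_(t-j)] are
    controlled uniformly by a Chernoff bound for summands truncated at level
    [x / M], with exponent [L = (delta / 4) ln x]: the single large summands cost
    at most [C (\sum_(j >= N) |a_j| ^ delta) f x] by Potter's bound, and the
    truncated sum exceeds [x] with probability [O(x ^ (- M delta / 4)) = o(f x)]
    once [M delta > 4 alpha]. Hence [Y] and [Yopt] have right tails asymptotic
    to [eta_+(a,0) f] and [eta_+(a,h) f].

    By causality and invertibility the past of [Y] and the past of [eps]
    coincide up to null sets, and [Y_(t+h) = Z + Yopt] with [Z] independent of
    that past. So for an event [A] of the past, [Y_(t+h) > y] and [A] occur
    together with probability at most
    [P(Yopt > (1-e) y) + P(A) P(Z > e y)], while if [A] contains
    [Yopt > (1+e) y] they do with probability at least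
    [P(Yopt > (1+e) y) P(|Z| <= e y)]. Taking [y] to be the [p]-quantile of
    [Y_(t+h)], dividing by [1 - p] and letting [p] tend to [1] and then [e] to
    [0] gives both limits. An admissible [A] with probability exactly [1 - p]
    exists because the infinite iid past has no atoms. *)
Require Import Defs.
From HB Require Import structures.
From mathcomp Require Import all_boot all_order all_algebra.
From mathcomp Require Import all_classical all_reals all_analysis.
(* Required again after all_analysis: otherwise the measurable structure of
   [\bar R] is not inferred. *)
From mathcomp Require Import measurable_realfun lebesgue_measure ring lra.
Set Implicit Arguments. Unset Strict Implicit. Unset Printing Implicit Defensive.
Import Order.TTheory GRing.Theory Num.Theory.
Import numFieldNormedType.Exports.
Local Open Scope classical_set_scope.
Local Open Scope ring_scope.

(** * Independence of disjoint blocks *)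

(** The asymptotics of finite sums come with thresholds that depend on the number of summands, so
    they do not pass to infinite sums; hence a Chernoff bound whose threshold is common to all
    windows. One exponent [delta], that of [C_alpha], serves throughout: being below [alpha], it
    gives a finite moment and a Potter bound with summable coefficients; being at most 2, it lets a
    second-order expansion of the exponential suffice. The linear term of that expansion appears
    only for [delta > 1]; then [alpha > 1] and the mean is 0.

    Laws may have atoms. The tail at a quantile is then only asymptotic to [1 - p], and no
    exceedance event of [Yopt] need have probability exactly [1 - p]; the witness for the lower
    bound is the indicator of an event built for the purpose.

    The series converge almost surely, whereas a predictor is an exact function of the past of [Y].
    Events are therefore formed in completed sigma-algebras and replaced at the end by almost surely
    equal ones.

    The main limits keep a margin [t > 1] fixed while the principal variable tends to its limit;
    only then does [t] decrease to 1. *)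

Section independence.
Context {R : realType} {d : measure_display} {T : measurableType d}.
Variable P : probability T R.
Implicit Types (X : int -> T -> R) (I J : set int).

(** [past_sigma X t] is convertible to [family_sigma X [set s | s <= t]]. *)
Definition family_sigma X I : set (set T) :=
  <<s [set C | exists s (A : set R), I s /\ measurable A /\ C = X s @^-1` A] >>.

(** The pi-system generating [family_sigma X I], written with a list of distinct indices and one set
    per integer so that the product formula of [iid] applies as it stands. *)
Definition cylinder X I : set (set T) :=
  [set C | exists (s : seq int) (B : int -> set R),
    [/\ uniq s, {subset s <= [pred i | `[< I i >]]},
        forall i, measurable (B i) & C = \bigcap_(i in [set` s]) (X i @^-1` B i)]].

Lemma cylinder_setI X I : setI_closed (cylinder X I).
Proof.
move=> _ _ [s [B [us sI mB ->]]] [s' [B' [us' sI' mB' ->]]].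
(* Padding by [setT] outside its list lets two cylinders be intersected index by index over the
   merged list. *)
pose D (s : seq int) (B : int -> set R) i := if i \in s then B i else setT.
have mD s0 B0 : (forall i, measurable (B0 i)) -> forall i, measurable (D s0 B0 i).
  by move=> mB0 i; rewrite /D; case: ifP.
exists (undup (s ++ s')), (fun i => D s B i `&` D s' B' i); split.
- exact: undup_uniq.
- by move=> i; rewrite mem_undup mem_cat => /orP[/sI|/sI'].
- by move=> i; apply: measurableI; exact: mD.
- apply/seteqP; split => w.
    move=> [h h'] i /=; rewrite mem_undup mem_cat /D => _.
    by split; case: ifP => // iS; [exact: h|exact: h'].
  move=> h; split => i /= iS.
    by have := h i; rewrite /= mem_undup mem_cat iS /D iS => /(_ erefl)[].
  have := h i; rewrite /= mem_undup mem_cat iS orbT /D iS => /(_ erefl)[]//.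
Qed.

Lemma cylinderT X I : cylinder X I setT.
Proof.
exists [::], (fun=> setT); split => //.
by apply/seteqP; split => // w _ i.
Qed.

Lemma family_sigma_cylinder X I : family_sigma X I `<=` <<s cylinder X I >>.
Proof.
apply: sub_sigma_algebra2 => C [s [A [Is [mA ->]]]].
exists [:: s], (fun=> A); split => //.
- by move=> i; rewrite inE => /eqP ->; apply/asboolP.
- apply/seteqP; split => w /=; first by move=> h i /=; rewrite inE => /eqP ->.
  by move=> /(_ s); apply => /=; rewrite inE.
Qed.

Lemma cylinder_measurable X I :
  (forall i, measurable_fun setT (X i)) -> cylinder X I `<=` measurable.
Proof.
move=> mX _ [s [B [us sI mB ->]]].
apply: fin_bigcap_measurable => // i _.
by rewrite -[X in measurable X]setTI; exact: mX.
Qed.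

Lemma family_sigma_measurable X I :
  (forall i, measurable_fun setT (X i)) -> family_sigma X I `<=` measurable.
Proof.
move=> mX; apply: smallest_sub; first exact: sigma_algebra_measurable.
move=> _ [s [A [_ [mA ->]]]].
by rewrite -[X in measurable X]setTI; exact: mX.
Qed.

Lemma family_sigma_sub X I J : I `<=` J -> family_sigma X I `<=` family_sigma X J.
Proof.
move=> IJ; apply: sub_sigma_algebra2 => C [s [A [Is mAC]]].
by exists s, A; split => //; exact: IJ.
Qed.

(** The restriction of [P] to [B] and [P] scaled by [P B] are finite measures that agree on the
    intersection-stable class [G]; uniqueness of measures extends the agreement to the generated
    sigma-algebra. *)
Lemma indep_extend (G : set (set T)) (B : set T) :
  G `<=` measurable -> setI_closed G -> G setT -> measurable B ->
  (forall A, G A -> P (A `&` B) = (P A * P B)%E) ->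
  forall A, <<s G >> A -> P (A `&` B) = (P A * P B)%E.
Proof.
move=> Gm GI GT mB GB A GA.
have PB0 : 0 <= fine (P B) by rewrite fine_ge0.
pose m1 := mrestr P mB.
pose m2 := mscale (NngNum PB0) P.
have E : m1 A = m2 A.
  apply: (g_sigma_algebra_measure_unique G Gm (fun=> setT)) => //.
  - by rewrite bigcup_const.
  - move=> C GC; change (P (C `&` B) = ((fine (P B))%:E * P C)%E).
    by rewrite GB// muleC fineK// fin_num_measure.
  - move=> k; change (P (setT `&` B) < +oo)%E.
    by rewrite setTI ltey_eq fin_num_measure.
have {}E : P (A `&` B) = ((fine (P B))%:E * P A)%E := E.
by rewrite E muleC fineK// fin_num_measure.
Qed.

(** Disjointness of [I] and [J] keeps the concatenated index list free of repetitions, and the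
    product over it splits. *)
Lemma iid_cylinder_indep X I J : iid P X -> I `&` J = set0 ->
  forall A B, cylinder X I A -> cylinder X J B -> P (A `&` B) = (P A * P B)%E.
Proof.
move=> [mX [indX _]] IJ0 _ _ [s [A [us sI mA ->]]] [s' [B [us' sJ mB ->]]].
pose C i := if i \in s then A i else B i.
have sNs' i : i \in s' -> i \in s = false.
  move=> is'; apply/negP => /sI/asboolP Ii.
  by have /asboolP Ji := sJ _ is'; have : (I `&` J) i by []; rewrite IJ0.
have us2 : uniq (s ++ s').
  rewrite cat_uniq us us' andbT/=.
  by apply/hasPn => i is'; rewrite /= sNs'.
have -> : \bigcap_(i in [set` s]) (X i @^-1` A i) `&`
          \bigcap_(i in [set` s']) (X i @^-1` B i) =
          \bigcap_(i in [set` s ++ s']) (X i @^-1` C i).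
  apply/seteqP; split => w.
    move=> [h h'] i /=; rewrite mem_cat /C => /orP[] iS.
      by rewrite iS; exact: h.
    by rewrite (sNs' _ iS); exact: h'.
  move=> h; split => i /= iS.
    by have := h i; rewrite /= mem_cat iS /C iS; apply.
  by have := h i; rewrite /= mem_cat iS orbT /C (sNs' _ iS); apply.
rewrite indX//; last by move=> i; rewrite /C; case: ifP.
rewrite big_cat/= !indX//; congr (_ * _)%E.
  by rewrite big_seq [RHS]big_seq; apply: eq_bigr => i iS; rewrite /C iS.
by rewrite big_seq [RHS]big_seq; apply: eq_bigr => i iS; rewrite /C sNs'.
Qed.

(** The factors are enlarged from cylinders to sigma-algebras one at a time, each use of
    [indep_extend] keeping the other factor fixed. *)
Lemma iid_indep X I J : iid P X -> I `&` J = set0 ->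
  forall A B, family_sigma X I A -> family_sigma X J B ->
  P (A `&` B) = (P A * P B)%E.
Proof.
move=> iidX IJ0 A B IA JB; have mX := iidX.1.
apply: (@indep_extend (cylinder X I)) => //.
- exact: cylinder_measurable.
- exact: cylinder_setI.
- exact: cylinderT.
- exact: family_sigma_measurable JB.
- move=> {IA}A IA; rewrite setIC muleC.
  apply: (@indep_extend (cylinder X J)) => //.
  + exact: cylinder_measurable.
  + exact: cylinder_setI.
  + exact: cylinderT.
  + exact: cylinder_measurable IA.
  + move=> {JB}B JB; rewrite setIC muleC.
    exact: (iid_cylinder_indep iidX IJ0).
  + exact: family_sigma_cylinder.
- exact: family_sigma_cylinder.
Qed.

End independence.

Section expectation_prod.
Context {R : realType} {d : measure_display} {T : measurableType d}.
Variable P : probability T R.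

(** Independence makes the law of [(U, V)] the product of the two laws, and Tonelli separates the
    integral. *)
Lemma ge0_integral_prod_indep (U V : {mfun T >-> R}) :
  (forall w, 0 <= U w) -> (forall w, 0 <= V w) ->
  (forall A B : set R, measurable A -> measurable B ->
    P (U @^-1` A `&` V @^-1` B) = (P (U @^-1` A) * P (V @^-1` B))%E) ->
  (\int[P]_w (U w * V w)%:E = \int[P]_w (U w)%:E * \int[P]_w (V w)%:E)%E.
Proof.
move=> U0 V0 ind.
have mUV : measurable_fun setT (fun w => (U w, V w)) by exact: measurable_fun_pair.
pose W : {mfun T >-> (R * R)%type} :=
  HB.pack (fun w => (U w, V w)) (isMeasurableFun.Build _ _ _ _ _ mUV).
(* The absolute values make the integrand nonnegative on the whole plane, as Tonelli requires; on
   the range of [(U, V)] they change nothing. *)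
pose g (x : R * R) : \bar R := (`|x.1| * `|x.2|)%:E.
have mg : measurable_fun (setT : set (measurableTypeR R * measurableTypeR R)%type) g.
  apply: measurableT_comp => //; apply: measurable_funM.
    by apply: measurableT_comp => //; exact: measurable_fst.
  by apply: measurableT_comp => //; exact: measurable_snd.
have g0 x : (0 <= g x)%E by rewrite lee_fin mulr_ge0.
transitivity (\int[P]_w (g \o W) w)%E.
  by apply: eq_integral => w _; rewrite /g/= !ger0_norm.
rewrite -ge0_integral_distribution//.
transitivity (\int[distribution P U \x distribution P V]_x g x)%E.
  apply: eq_measure_integral => A mA _; apply/esym.
  by apply: product_measure_unique.
rewrite fubini_tonelli1//= /fubini_F/=.
have mN : measurable_fun setT (fun x : R => `|x|%:E).
  by apply: measurableT_comp => //; exact: measurable_normr.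
have absV : (\int[distribution P V]_y `|y|%:E = \int[P]_w (V w)%:E)%E.
  by rewrite ge0_integral_distribution//; apply: eq_integral => w _ /=; rewrite ger0_norm.
transitivity (\int[distribution P U]_x (`|x|%:E * \int[P]_w (V w)%:E))%E.
  apply: eq_integral => x _; rewrite -absV -ge0_integralZl//.
rewrite ge0_integralZr//; last by apply: integral_ge0 => w _; rewrite lee_fin.
congr (_ * _)%E.
by rewrite ge0_integral_distribution//; apply: eq_integral => w _ /=; rewrite ger0_norm.
Qed.

End expectation_prod.

(** * Measurability up to null sets *)

Section completion.
Context {R : realType} {d : measure_display} {T : measurableType d}.
Variable P : probability T R.
Implicit Types G : set (set T).

(** Phrased as [measurable_fun] over the type generated by [G], so that closure under sums, products
    and upper limits is available; [measurable_wrtP] returns to preimages. *)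
Definition measurable_wrt G (X : T -> R) :=
  measurable_fun (setT : set (g_sigma_algebraType G)) (X : g_sigma_algebraType G -> R).

Lemma measurable_wrtP G X : sigma_algebra setT G ->
  measurable_wrt G X <-> (forall B : set R, measurable B -> G (X @^-1` B)).
Proof.
move=> sG; split => [mX B mB|h _ B mB].
  have := mX measurableT B mB; rewrite setTI.
  by rewrite /measurable/= sigma_algebra_id.
by rewrite setTI; apply: sub_sigma_algebra; exact: h.
Qed.

(** A member need not be measurable in [T], since the symmetric difference is only contained in a
    null set. Where its probability matters, measurability is required separately. *)
Definition null_completion G : set (set T) :=
  [set C | exists2 C', G C' & P.-negligible ((C `\` C') `|` (C' `\` C))].

Lemma sub_null_completion G : G `<=` null_completion G.
Proof.
by move=> C GC; exists C => //; rewrite setDv setU0; exact: negligible_set0.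
Qed.

Lemma null_completion_sigma G : sigma_algebra setT G ->
  sigma_algebra setT (null_completion G).
Proof.
move=> [G0 GC GU]; split.
- exact: sub_null_completion.
- move=> A [A' GA' nA]; exists (setT `\` A'); first exact: GC.
  apply: negligibleS nA => w [] /= [[_ a] b].
    by right; split => //; apply: contrapT => c; apply: b.
  by left; split => //; apply: contrapT => c; apply: b.
- move=> A hA; pose A' n := sval (cid2 (hA n)).
  have GA' n : G (A' n) by rewrite /A'; case: cid2.
  have nA' n : P.-negligible ((A n `\` A' n) `|` (A' n `\` A n)).
    by rewrite /A'; case: cid2.
  exists (\bigcup_n A' n); first exact: GU.
  apply: negligibleS (negligible_bigcup nA') => w [] [] [n _ h] h'.
    by exists n => //; left; split => // h2; apply: h'; exists n.
  by exists n => //; right; split => // h2; apply: h'; exists n.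
Qed.

Lemma null_completion_ae G (X L : T -> R) : sigma_algebra setT G ->
  {ae P, forall w, X w = L w} ->
  measurable_wrt (null_completion G) L -> measurable_wrt (null_completion G) X.
Proof.
move=> sG XL; have sG' := null_completion_sigma sG.
move/(measurable_wrtP _ sG') => mL; apply/(measurable_wrtP _ sG') => B mB.
have [C GC nC] := mL _ mB; exists C => //.
apply: negligibleS (negligibleU nC XL) => w.
have [e|ne] := pselect (X w = L w); last by right.
by rewrite /= e => -[[? ?]|[? ?]]; left; [left|right].
Qed.

(** The upper limit in the extended reals is measurable without any convergence, and it agrees with
    [X] almost surely, which the completion cannot distinguish. *)
Lemma null_completion_cvg G (X_ : nat -> T -> R) (X : T -> R) :
  sigma_algebra setT G ->
  (forall n, measurable_wrt (null_completion G) (X_ n)) ->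
  {ae P, forall w, X_ ^~ w @ \oo --> X w} ->
  measurable_wrt (null_completion G) X.
Proof.
move=> sG mX cX.
pose L (w : T) := fine (limn_esup (fun n => (X_ n w)%:E)).
apply: (@null_completion_ae _ _ L) => //.
  apply: filterS cX => w cw.
  have cE : (X_ n w)%:E @[n --> \oo] --> (X w)%:E.
    by apply: cvg_EFin; [exact: nearW | exact: cw].
  rewrite /L is_cvg_limn_esupE; last by apply/cvg_ex; exists (X w)%:E.
  by rewrite (cvg_lim _ cE).
apply: measurableT_comp; first exact: fine_measurable.
apply: (@measurable_fun_limn_esup _ (g_sigma_algebraType (null_completion G)) R setT (fun n w => (X_ n w)%:E)) => n.
by apply: measurableT_comp => //; exact: mX.
Qed.

Lemma negligible_measure_eq (A B : set T) : measurable A -> measurable B ->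
  P.-negligible ((A `\` B) `|` (B `\` A)) -> P A = P B.
Proof.
move=> mA mB nAB.
have n1 : P (A `\` B) = 0.
  by apply: measure_negligible; [exact: measurableD|apply: negligibleS nAB; left].
have n2 : P (B `\` A) = 0.
  by apply: measure_negligible; [exact: measurableD|apply: negligibleS nAB; right].
have e1 : P A = (P (A `\` B) + P (A `&` B))%E := measureDI P mA mB.
have e2 : P B = (P (B `\` A) + P (B `&` A))%E := measureDI P mB mA.
by rewrite e1 e2 n1 n2 setIC.
Qed.

(** Since [C'] does not depend on [B], independence of [G] from a given event carries over to the
    measurable members of its completion. *)
Lemma null_completion_measure_eq G C : G `<=` measurable -> measurable C ->
  null_completion G C ->
  exists C', [/\ G C', P C = P C' &
    forall B, measurable B -> P (C `&` B) = P (C' `&` B)].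
Proof.
move=> Gm mC [C' GC' nC]; exists C'; split => //.
  by apply: negligible_measure_eq => //; exact: Gm.
move=> B mB; apply: negligible_measure_eq.
- exact: measurableI.
- by apply: measurableI => //; exact: Gm.
- apply: negligibleS nC => w [] [[a b] c].
    by left; split => // c'; apply: c; split.
  by right; split => // c'; apply: c; split.
Qed.

End completion.

(** * Regularly varying functions *)

Section real_limits.
Context {R : realType}.
Implicit Types (f g G : R -> R) (alpha beta delta c : R).

Lemma near_pinftyW (Q : R -> Prop) :
  (\forall x \near +oo, Q x) -> exists2 M : R, 0 < M & forall x, M <= x -> Q x.
Proof.
move=> [M [_ MQ]]; exists (Num.max M 0 + 1).
  by rewrite ltr_pwDr// le_max lexx orbT.
by move=> x Mx; apply: MQ; apply: lt_le_trans Mx; rewrite ltr_pwDr// le_max lexx.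
Qed.

(** The bounds [g] may depend on the margin [t] and need only converge for each fixed [t]; their
    limits are compared with [rho] afterwards. No upper or lower limit of [phi] has to be
    introduced. *)
Lemma cvg_squeeze_family {T0 : Type} (F : set_system T0) {FF : ProperFilter F}
    (phi : T0 -> R) (u l : R -> R) (rho : R) :
  (forall t, 1 < t -> exists (g : T0 -> R) v,
    [/\ \forall x \near F, phi x <= g x, g @ F --> v & v <= u t]) ->
  (forall t, 1 < t -> exists (g : T0 -> R) v,
    [/\ \forall x \near F, g x <= phi x, g @ F --> v & l t <= v]) ->
  u @ 1^'+ --> rho -> l @ 1^'+ --> rho -> phi @ F --> rho.
Proof.
move=> Hu Hl cu cl; apply/cvgrPdist_le => e e0.
have ue : \forall t \near (1:R)^'+, u t < rho + e.
  by apply: (cvgr_lt _ cu); rewrite ltrDl.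
have le : \forall t \near (1:R)^'+, rho - e < l t.
  by apply: (cvgr_gt _ cl); rewrite gtrBl.
have [t [t1 ut lt]] : exists t, [/\ 1 < t, u t < rho + e & rho - e < l t].
  have : \forall t \near (1:R)^'+, [/\ 1 < t, u t < rho + e & rho - e < l t].
    by near=> t; split; near: t; [exact: nbhs_right_gt|exact: ue|exact: le].
  by move=> /filter_ex.
have [g [gv [pg gu vu]]] := Hu _ t1.
have [k [kv [pk kl vl]]] := Hl _ t1.
near=> x.
have h1 : phi x <= g x by near: x.
have h2 : k x <= phi x by near: x.
have h3 : g x < rho + e by near: x; apply: (cvgr_lt _ gu); exact: le_lt_trans ut.
have h4 : rho - e < k x by near: x; apply: (cvgr_gt _ kl); exact: lt_le_trans vl.
rewrite ler_distlC; lra.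
Unshelve. all: by end_near. Qed.

Lemma powR_cvg_at1 c beta : (fun t : R => c * t `^ beta) @ 1^'+ --> c.
Proof.
rewrite -[X in _ --> X]mulr1; apply: cvgM; first exact: cvg_cst.
apply: cvg_at_right_filter.
have e1 : expR (beta * ln 1) = 1 :> R by rewrite ln1 mulr0 expR0.
have h : (expR (beta * ln t)) @[t --> (1 : R)] --> expR (beta * ln 1).
  apply: continuous_cvg; first exact: continuous_expR.
  by apply: cvgM; [exact: cvg_cst|exact: continuous_ln].
rewrite e1 in h.
apply: cvg_trans h; apply: near_eq_cvg; near=> t.
by rewrite /powR gt_eqF//; near: t; exact: lt_nbhsr.
Unshelve. all: by end_near. Qed.

Lemma cvg_pinfty_scale f (l k : R) : 0 < k -> f @ +oo --> l ->
  (fun x => f (k * x)) @ +oo --> l.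
Proof.
move=> k0; apply: cvg_comp; apply/cvgryPge => A.
near=> x; rewrite mulrC -ler_pdivrMr//; near: x; exact: nbhs_pinfty_ge.
Unshelve. all: by end_near. Qed.

Lemma tail_scale f G alpha c (k : R) : regularly_varying_fun f (- alpha) ->
  (fun x => G x / f x) @ +oo --> c -> 0 < k ->
  (fun x => G (k * x) / f x) @ +oo --> c * k `^ (- alpha).
Proof.
move=> [fpos rv] Gc k0.
have h : (fun x => (G (k * x) / f (k * x)) * (f (x * k) / f x)) @ +oo --> c * k `^ (- alpha).
  by apply: cvgM; [exact: (cvg_pinfty_scale k0 Gc)|exact: rv].
apply: cvg_trans h; apply: near_eq_cvg.
have [M M0 fM] := near_pinftyW fpos; near=> x.
have hx : 0 < f (k * x).
  apply: fM; rewrite mulrC -ler_pdivrMr//; near: x; exact: nbhs_pinfty_ge.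
by rewrite (mulrC x k) mulrA divfK// gt_eqF.
Unshelve. all: by end_near. Qed.

Lemma pow2_bracket (x : R) : 1 <= x -> exists k, 2 ^+ k <= x < 2 ^+ k.+1.
Proof.
move=> x1.
have [n xn] : exists n, x < 2 ^+ n.
  exists (Num.truncn x).+1; apply: lt_trans (truncnS_gt x) _.
  by rewrite -natrX ltr_nat ltn_expl.
have := ex_minnP (ex_intro (fun n => x < 2 ^+ n) n xn).
case=> -[|k]; first by rewrite expr0 ltNge x1.
move=> xk1 kmin; exists k; rewrite xk1 andbT leNgt; apply/negP => /kmin.
by rewrite ltnn.
Qed.

Lemma powRN_le (a b r : R) : 0 < a -> a <= b -> 0 <= r -> b `^ (- r) <= a `^ (- r).
Proof.
move=> a0 ab r0; have b0 := lt_le_trans a0 ab.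
rewrite !powRN lef_pV2 ?posrE ?powR_gt0//.
by apply: ge0_ler_powR => //; rewrite nnegrE ltW.
Qed.

Lemma powR_lt_exp (a x y : R) : 1 < a -> x < y -> a `^ x < a `^ y.
Proof.
move=> a1 xy; rewrite /powR gt_eqF ?(lt_trans ltr01)//.
by rewrite ltr_expR ltr_pM2r// ln_gt0.
Qed.

(** The limit of [f (2 x) / f x] is strictly below 2 to the power [- delta], so beyond one threshold
    every doubling gains at least that factor, and doublings can be iterated. *)
Lemma rv_pow2_upper f alpha delta : regularly_varying_fun f (- alpha) -> delta < alpha ->
  exists2 x0, 0 < x0 & (forall x, x0 <= x -> 0 < f x) /\
    (forall k x, x0 <= x -> f (2 ^+ k * x) <= (2 ^+ k) `^ (- delta) * f x).
Proof.
move=> [fpos rv] da.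
have h : \forall x \near +oo, f (x * 2) / f x < 2 `^ (- delta).
  apply: (cvgr_lt _ (rv 2 _)) => //.
  by rewrite !powRN ltf_pV2 ?posrE ?powR_gt0// powR_lt_exp ?ltr1n.
have [M M0 fM] := near_pinftyW fpos; have [N N0 fN] := near_pinftyW h.
have xM x : Num.max M N <= x -> 0 < f x by rewrite ge_max => /andP[+ _]; exact: fM.
exists (Num.max M N); first by rewrite lt_max M0.
split => // k x Mx.
have x0 : 0 < x by apply: lt_le_trans Mx; rewrite lt_max M0.
elim: k => [|k IH]; first by rewrite expr0 mul1r powR1 mul1r.
have kx : Num.max M N <= 2 ^+ k * x.
  by apply: le_trans Mx _; rewrite ler_peMl ?(ltW x0)// exprn_ege1// ler1n.
rewrite exprSr powRM ?exprn_ge0// (mulrAC _ 2 x) [_ `^ _ * 2 `^ _]mulrC -[leRHS]mulrA.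
have : f (2 ^+ k * x * 2) <= 2 `^ (- delta) * f (2 ^+ k * x).
  rewrite -ler_pdivrMr ?xM//; apply/ltW/fN.
  by apply: le_trans kx; rewrite le_max lexx orbT.
by move=> /le_trans; apply; rewrite ler_wpM2l ?powR_ge0//.
Qed.

Lemma rv_pow2_lower f alpha beta : regularly_varying_fun f (- alpha) -> alpha < beta ->
  exists2 x0, 0 < x0 & (forall x, x0 <= x -> 0 < f x) /\
    (forall k x, x0 <= x -> (2 ^+ k) `^ (- beta) * f x <= f (2 ^+ k * x)).
Proof.
move=> [fpos rv] da.
have h : \forall x \near +oo, 2 `^ (- beta) < f (x * 2) / f x.
  apply: (cvgr_gt _ (rv 2 _)) => //.
  by rewrite !powRN ltf_pV2 ?posrE ?powR_gt0// powR_lt_exp ?ltr1n.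
have [M M0 fM] := near_pinftyW fpos; have [N N0 fN] := near_pinftyW h.
have xM x : Num.max M N <= x -> 0 < f x by rewrite ge_max => /andP[+ _]; exact: fM.
exists (Num.max M N); first by rewrite lt_max M0.
split => // k x Mx.
have x0 : 0 < x by apply: lt_le_trans Mx; rewrite lt_max M0.
elim: k => [|k IH]; first by rewrite expr0 mul1r powR1 mul1r.
have kx : Num.max M N <= 2 ^+ k * x.
  by apply: le_trans Mx _; rewrite ler_peMl ?(ltW x0)// exprn_ege1// ler1n.
rewrite exprSr powRM ?exprn_ge0// (mulrAC _ 2 x) [_ `^ _ * 2 `^ _]mulrC -[leLHS]mulrA.
have : 2 `^ (- beta) * f (2 ^+ k * x) <= f (2 ^+ k * x * 2).
  rewrite -ler_pdivlMr ?xM//; apply/ltW/fN.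
  by apply: le_trans kx; rewrite le_max lexx orbT.
by move=> H; apply: le_trans H; rewrite ler_wpM2l ?powR_ge0.
Qed.

(** Monotonicity interpolates between powers of 2 and replaces the uniform convergence theorem;
    rounding [t] down to a power of 2 costs the factor 2 to the power [delta]. *)
Lemma potter_upper f alpha delta : regularly_varying_fun f (- alpha) ->
  {homo f : x y / x <= y >-> y <= x} -> 0 < delta < alpha ->
  exists2 x0, 0 < x0 & (forall x, x0 <= x -> 0 < f x) /\
    (forall x t, x0 <= x -> 1 <= t -> f (t * x) <= 2 `^ delta * t `^ (- delta) * f x).
Proof.
move=> rv fmono /andP[d0 da].
have [x0 x00 [fpos fk]] := rv_pow2_upper rv da.
exists x0 => //; split => // x t xx t1.
have x_0 : 0 < x by exact: lt_le_trans xx.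
have [k /andP[kt tk]] := pow2_bracket t1.
apply: le_trans (fmono _ _ (ler_wpM2r (ltW x_0) kt)) _.
apply: le_trans (fk k x xx) _; rewrite ler_wpM2r ?(ltW (fpos _ _))//.
have -> : 2 `^ delta * t `^ (- delta) = (t / 2) `^ (- delta).
  rewrite powRM ?invr_ge0 ?(le_trans _ t1)// mulrC; congr (_ * _).
  by rewrite -powR_inv1// -powRrM mulN1r opprK.
apply: powRN_le; last exact: ltW.
  by rewrite divr_gt0// (lt_le_trans _ t1).
by rewrite ler_pdivrMr// -exprSr ltW.
Qed.

Lemma potter_lower f alpha beta : regularly_varying_fun f (- alpha) ->
  {homo f : x y / x <= y >-> y <= x} -> 0 < alpha < beta ->
  exists2 x0, 0 < x0 & exists2 c, 0 < c & forall x, x0 <= x -> c * x `^ (- beta) <= f x.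
Proof.
move=> rv fmono /andP[a0 ab].
have [x0 x00 [fpos fk]] := rv_pow2_lower rv ab.
(* Here [x / x0] is rounded up to a power of 2, which is at most [2 * x / x0]; the factors free of
   [x] form the constant. *)
exists x0 => //; exists ((2 / x0) `^ (- beta) * f x0).
  by rewrite mulr_gt0 ?powR_gt0 ?divr_gt0 ?fpos.
move=> x xx; have x_0 : 0 < x by exact: lt_le_trans xx.
have t1 : 1 <= x / x0 by rewrite ler_pdivlMr// mul1r.
have [k /andP[kt tk]] := pow2_bracket t1.
have : f (2 ^+ k.+1 * x0) <= f x by apply: fmono; rewrite -ler_pdivrMr// ltW.
apply: le_trans; apply: le_trans (fk _ _ (lexx _)).
rewrite mulrAC ler_wpM2r ?(ltW (fpos _ _))//.
rewrite -powRM ?(ltW x_0) ?divr_ge0 ?(ltW x00)//; apply: powRN_le.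
- by rewrite exprn_gt0.
- by rewrite exprS -mulrA (mulrC _^-1) ler_wpM2l.
- by rewrite ltW// (lt_trans a0).
Qed.

End real_limits.

(** * Chernoff bound for truncated sums *)

Section exp_bounds.
Context {R : realType}.
Implicit Types (u L delta : R).

Lemma expR_le1MexpR u : expR u <= 1 + u * expR u.
Proof.
have := expR_ge1Dx (- u); rewrite expRN.
have e0 := expR_gt0 u.
rewrite -(ler_pM2r e0) mulVf ?gt_eqF// mulrBl mul1r => h; lra.
Qed.

Lemma expR_le_quad u : expR u <= 1 + u + u ^+ 2 * expR `|u|.
Proof.
have [u0|u0] := leP 0 u.
  have h := expR_le1MexpR u.
  have : u * expR u <= u * (1 + u * expR u) by rewrite ler_wpM2l.
  rewrite ger0_norm// expr2 -mulrA mulrDr mulr1; lra.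
have h1 : 1 + u * expR u >= expR u by exact: expR_le1MexpR.
have h2 : u * (1 + u) >= u * expR u by rewrite ler_wnM2l ?(ltW u0)// expR_ge1Dx.
have h3 : 1 <= expR (- u) by rewrite -expR0 ler_expR; lra.
have h4 : u ^+ 2 * 1 <= u ^+ 2 * expR (- u) by rewrite ler_wpM2l ?sqr_ge0.
rewrite ltr0_norm//; rewrite mulr1 in h4; rewrite mulrDr mulr1 -expr2 in h2.
lra.
Qed.

(** Used with [q = 1] for [delta <= 1] and with [q = 2] for [1 < delta <= 2]. The surplus exponent
    is at most 1 and costs one factor [L], which [le_expR_self] later absorbs into
    [expR (2 * L)]. *)
Lemma powR_interp u (delta q L : R) : 0 <= u <= L -> 1 <= L -> 0 < delta -> delta <= q <= delta + 1 ->
  u `^ q <= u `^ delta * L.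
Proof.
move=> /andP[u0 uL] L1 d0 /andP[dq qd].
have [->|un0] := eqVneq u 0.
  by rewrite !powR0 ?mul0r// gt_eqF// (lt_le_trans d0).
have -> : q = delta + (q - delta) by rewrite addrC subrK.
rewrite powRD ?un0 ?implybT// ler_wpM2l ?powR_ge0//.
have h : (L `^ (q - delta) <= L) by apply: ler1_powR => //; lra.
apply: le_trans h; apply: ge0_ler_powR; rewrite ?nnegrE//; first lra.
exact: le_trans u0 uL.
Qed.

Lemma le_expR_self L : L <= expR L.
Proof. have := expR_ge1Dx L; lra. Qed.

Lemma expR_trunc_le u L delta : 0 < delta <= 1 -> 1 <= L -> `|u| <= L ->
  expR u <= 1 + `|u| `^ delta * expR (2 * L).
Proof.
move=> /andP[d0 d1] L1 uL.
apply: (@le_trans _ _ (1 + `|u| * expR L)).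
  have [u0|u0] := leP 0 u.
    apply: le_trans (expR_le1MexpR u) _.
    rewrite lerD2l (ger0_norm u0) ler_wpM2l// ler_expR; exact: le_trans (ler_norm _) uL.
  have : expR u <= 1 by rewrite -expR0 ler_expR ltW.
  have : 0 <= `|u| * expR L by rewrite mulr_ge0// expR_ge0.
  lra.
rewrite lerD2l.
have : `|u| `^ 1 <= `|u| `^ delta * L by apply: powR_interp => //; rewrite ?normr_ge0//; lra.
rewrite powRr1// => h.
have -> : expR (2 * L) = expR L * expR L by rewrite -expRD mulr_natl mulr2n.
rewrite mulrA ler_wpM2r ?expR_ge0//; apply: le_trans h _.
by rewrite ler_wpM2l ?powR_ge0// le_expR_self.
Qed.

Lemma expR_trunc_le2 u L delta : 1 < delta <= 2 -> 1 <= L -> `|u| <= L ->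
  expR u <= 1 + u + `|u| `^ delta * expR (2 * L).
Proof.
move=> /andP[d1 d2] L1 uL.
apply: le_trans (expR_le_quad u) _; rewrite lerD2l -real_normK ?num_real//.
have : `|u| `^ 2 <= `|u| `^ delta * L by apply: powR_interp => //; rewrite ?normr_ge0//; lra.
rewrite powR_mulrn// => h.
have -> : expR (2 * L) = expR L * expR L by rewrite -expRD mulr_natl mulr2n.
rewrite mulrA; apply: ler_pM; rewrite ?expR_ge0 ?exprn_ge0 ?ler_expR//.
apply: le_trans h _.
by rewrite ler_wpM2l ?powR_ge0// le_expR_self.
Qed.

(** Beyond the level the truncated exponential is 1, while the bound keeps the possibly negative
    term [u]; as [|u| > 1], the power outweighs it. The same bound then holds on both sides of the
    level, so the mean of the untruncated variable can be used. *)
Lemma one_le_trunc2 u L delta : 1 < delta -> 1 <= L -> L < `|u| ->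
  1 <= 1 + u + `|u| `^ delta * expR (2 * L).
Proof.
move=> d1 L1 uL.
have h1 : `|u| <= `|u| `^ delta.
  by apply: le1r_powR; [exact: le_trans L1 (ltW uL)|exact: ltW].
have h2 : 1 <= expR (2 * L).
  by rewrite -expR0 ler_expR mulr_ge0// (le_trans ler01).
have h3 : `|u| `^ delta * 1 <= `|u| `^ delta * expR (2 * L) by rewrite ler_wpM2l ?powR_ge0.
have := ler_norm (- u); rewrite normrN => h4; clear L1 uL d1; lra.
Qed.

End exp_bounds.

(** * Real-valued probabilities and moments *)

Section pr.
Context {R : realType} {d : measure_display} {T : measurableType d}.
Variable P : probability T R.

(** Convertible to the tails and to the terms of [condprob], whose inequalities thereby become real
    arithmetic. *)
Definition pr (A : set T) : R := fine (P A).

Lemma prE A : measurable A -> (pr A)%:E = P A.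
Proof. by move=> mA; rewrite /pr fineK// fin_num_measure. Qed.

Lemma pr_ge0 A : 0 <= pr A.
Proof. by rewrite /pr fine_ge0. Qed.

Lemma pr_le A B : measurable A -> measurable B -> A `<=` B -> pr A <= pr B.
Proof. by move=> mA mB AB; rewrite -lee_fin !prE// le_measure ?inE. Qed.

Lemma pr_le1 A : measurable A -> pr A <= 1.
Proof. by move=> mA; rewrite -lee_fin prE// probability_le1. Qed.

Lemma prU_le A B : measurable A -> measurable B -> pr (A `|` B) <= pr A + pr B.
Proof.
move=> mA mB; rewrite -lee_fin EFinD !prE//; last exact: measurableU.
exact: measureU2.
Qed.

Lemma prU A B : measurable A -> measurable B -> A `&` B = set0 ->
  pr (A `|` B) = pr A + pr B.
Proof.
move=> mA mB AB; apply: EFin_inj; rewrite EFinD !prE//; last exact: measurableU.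
by rewrite measureU.
Qed.

Lemma prC A : measurable A -> pr (~` A) = 1 - pr A.
Proof.
move=> mA; apply: EFin_inj; rewrite EFinB !prE//; last exact: measurableC.
by rewrite probability_setC.
Qed.

Lemma prI_indep A B : measurable A -> measurable B ->
  P (A `&` B) = (P A * P B)%E -> pr (A `&` B) = pr A * pr B.
Proof.
move=> mA mB e; apply: EFin_inj; rewrite EFinM !prE//; exact: measurableI.
Qed.

Lemma pr_bigU_le (I : eqType) (s : seq I) (F : I -> set T) :
  (forall i, measurable (F i)) ->
  pr (\big[setU/set0]_(i <- s) F i) <= \sum_(i <- s) pr (F i).
Proof.
move=> mF; elim: s => [|i s IH]; first by rewrite !big_nil /pr measure0.
rewrite !big_cons; apply: le_trans (prU_le _ _) _ => //.
  exact: bigsetU_measurable.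
by rewrite lerD2l.
Qed.

End pr.

Section moments.
Context {R : realType} {d : measure_display} {T : measurableType d}.
Variable P : probability T R.
Implicit Types X : T -> R.

Lemma measurable_gt X (x : R) : measurable_fun setT X -> measurable [set w | x < X w].
Proof.
move=> mX; rewrite (_ : [set _ | _] = X @^-1` `]x, +oo[).
  by rewrite -[X in measurable X]setTI; apply: mX => //; exact: measurable_itv.
by apply/seteqP; split => w /=; rewrite in_itv/= andbT.
Qed.

Lemma measurable_abs_gt X (x : R) : measurable_fun setT X ->
  measurable [set w | x < `|X w|].
Proof.
move=> mX; apply: (@measurable_gt (fun w => `|X w|)).
exact: measurableT_comp.
Qed.

Lemma abs_tail_noninc X : measurable_fun setT X ->
  {homo abs_tail P X : x y / x <= y >-> y <= x}.
Proof.
move=> mX x y xy; apply: pr_le; [exact: measurable_abs_gt|exact: measurable_abs_gt|].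
by move=> w /=; exact: le_lt_trans.
Qed.

Lemma integral_prob_cst (c : R) : (\int[P]_w c%:E = c%:E)%E.
Proof.
transitivity (c%:E * P setT)%E; last by rewrite probability_setT mule1.
exact: (integral_cst P measurableT).
Qed.

(** The dyadic shells [2 ^ k * y0 <= |X| < 2 ^ k.+1 * y0] contribute a geometric
    series of ratio [2 `^ (delta - del')]. *)
Lemma moment_finite X (alpha delta : R) : measurable_fun setT X ->
  regularly_varying_fun (abs_tail P X) (- alpha) -> 0 < delta < alpha ->
  (\int[P]_w (`|X w| `^ delta)%:E < +oo)%E.
Proof.
move=> mX rv /andP[d0 da]; set f := abs_tail P X.
(* An exponent strictly between [delta] and [alpha] leaves room for a geometric ratio below 1. *)
pose del' := (delta + alpha) / 2.
have dd' : delta < del' by rewrite /del'; lra.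
have d'a : del' < alpha by rewrite /del'; lra.
have [x0 x00 [fpos fk]] := rv_pow2_upper rv d'a.
(* The factor 2 puts the closed lower end of each shell strictly inside the open event [A k]. *)
pose y0 := 2 * x0; have y00 : 0 < y0 by rewrite mulr_gt0.
pose A k := [set w | 2 ^+ k * x0 < `|X w|].
have mA k : measurable (A k) by exact: measurable_abs_gt.
pose c k : R := (2 ^+ k.+1 * y0) `^ delta.
have c0 k : 0 <= c k by exact: powR_ge0.
have mX1 : measurable_fun setT (fun w => (`|X w| `^ delta)%:E).
  apply/measurable_EFinP.
  have mN : measurable_fun setT (fun w => `|X w|) by exact: measurableT_comp.
  exact: (measurableT_comp (measurable_powR delta) mN).
have mck k : measurable_fun setT (fun w => (c k * \1_(A k) w)%:E).
  by apply: measurableT_comp => //; apply: measurable_funM => //; exact: measurable_indic.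
have ck0 k w : (0 <= (c k * \1_(A k) w)%:E)%E by rewrite lee_fin mulr_ge0.
have msum : measurable_fun setT (fun w => (\sum_(k <oo) (c k * \1_(A k) w)%:E)%E).
  exact: (@ge0_emeasurable_sum _ _ _ setT (fun k w => (c k * \1_(A k) w)%:E) xpredT).
apply: (@le_lt_trans _ _ (\int[P]_w ((y0 `^ delta)%:E + \sum_(k <oo) (c k * \1_(A k) w)%:E))%E).
  apply: ge0_le_integral => //.
  - exact: emeasurable_funD.
  - move=> w _.
    have sum0 : (0 <= \sum_(k <oo) (c k * \1_(A k) w)%:E)%E by exact: nneseries_ge0.
    have [Xy|yX] := leP `|X w| y0.
      apply: (@le_trans _ _ (y0 `^ delta)%:E); last by rewrite leeDl.
      by rewrite lee_fin; apply: ge0_ler_powR => //; rewrite ?nnegrE ?(ltW d0) ?(ltW y00).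
    apply: (@le_trans _ _ (\sum_(k <oo) (c k * \1_(A k) w)%:E)%E); last first.
      by rewrite leeDr// lee_fin powR_ge0.
    have t1 : 1 <= `|X w| / y0 by rewrite ler_pdivlMr// mul1r ltW.
    have [k /andP[kt tk]] := pow2_bracket t1.
    rewrite ler_pdivlMr// in kt; rewrite ltr_pdivrMr// in tk.
    apply: (@le_trans _ _ (c k * \1_(A k) w)%:E).
      rewrite indicE mem_set ?mulr1 ?lee_fin.
        apply: ge0_ler_powR; rewrite ?nnegrE ?normr_ge0 ?(ltW d0) ?(ltW tk)//.
        by rewrite mulr_ge0 ?exprn_ge0 ?(ltW y00).
      rewrite /A/=; apply: lt_le_trans kt.
      by rewrite ltr_pM2l ?exprn_gt0// /y0 ltr_pMl// ltr1n.
    rewrite (@nneseriesD1 _ _ k xpredT)//.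
    by rewrite leeDl// nneseries_ge0.
have cst0 (w : T) : [set: T] w -> (0 <= (y0 `^ delta)%:E)%E by rewrite lee_fin powR_ge0.
have sum0 w : setT w -> (0 <= \sum_(k <oo) (c k * \1_(A k) w)%:E)%E.
  by move=> _; exact: nneseries_ge0.
rewrite ge0_integralD//.
rewrite integral_prob_cst.
rewrite integral_nneseries//.
rewrite lte_add_pinfty ?ltry//.
pose r : R := 2 `^ (delta - del').
have r0 : 0 < r by exact: powR_gt0.
have r1 : `|r| < 1.
  rewrite ger0_norm ?(ltW r0)// /r.
  have := @powR_lt_exp R 2 (delta - del') 0.
  by rewrite powRr0 ltr1n subr_lt0; apply.
pose C : R := (2 * y0) `^ delta * f x0.
have C0 : 0 <= C by rewrite mulr_ge0 ?powR_ge0 ?pr_ge0.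
apply: (@le_lt_trans _ _ (C * (1 - r)^-1)%:E); last exact: ltry.
apply: lime_le.
  by apply: is_cvg_nneseries => k _ _; apply: integral_ge0.
apply: nearW => n.
apply: (@le_trans _ _ (\sum_(0 <= k < n) (geometric C r k)%:E)%E).
  apply: lee_sum => k _; under eq_integral do rewrite EFinM.
  have mI : measurable_fun setT (fun w => (\1_(A k) w)%:E : \bar R).
    by apply: measurableT_comp => //; exact: measurable_indic.
  rewrite ge0_integralZl_EFin//.
  have -> : (\int[P]_w (\1_(A k) w)%:E = (pr P (A k))%:E)%E.
    by rewrite integral_indic// setIT; exact/esym/(prE P (mA k)).
  rewrite -EFinM lee_fin /geometric/=.
  have h : pr P (A k) <= (2 ^+ k) `^ (- del') * f x0 by exact: fk.
  apply: le_trans (ler_wpM2l (c0 k) h) _.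
  rewrite /c /C exprSr -mulrA powRM ?exprn_ge0 ?mulr_ge0 ?(ltW y00) ?(ltW x00)//.
  rewrite le_eqVlt; apply/orP; left; apply/eqP.
  have -> : r ^+ k = (2 ^+ k) `^ delta * (2 ^+ k) `^ (- del').
    rewrite -powRD; last by rewrite expf_neq0// implybT.
    by rewrite -powR_mulrn ?ltW// /r powRAC powR_mulrn.
  ring.
rewrite sumEFin lee_fin.
exact: geometric_le_lim.
Qed.

End moments.

Section truncated_exponential.
Context {R : realType} {d : measure_display} {T : measurableType d}.
Variable P : probability T R.

(** The value beyond the level is [expR 0]: a large summand is dropped from the exponent and left to
    a union bound. *)
Definition trunc_expR (b L x : R) : R := if `|b * x| <= L then expR (b * x) else 1.

Lemma measurable_trunc_expR b L : measurable_fun setT (trunc_expR b L).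
Proof.
have mb : measurable_fun setT (fun x : R => b * x) by exact: measurable_funM.
apply: measurable_fun_ifT => //.
- by apply: measurable_fun_ler => //; exact: measurableT_comp.
- by apply: measurableT_comp mb; exact: measurable_expR.
Qed.

Lemma trunc_expR_ge0 b L x : 0 <= trunc_expR b L x.
Proof. by rewrite /trunc_expR; case: ifP => // _; exact: expR_ge0. Qed.

Lemma trunc_expR_le b L x : 0 <= L -> trunc_expR b L x <= expR L.
Proof.
move=> L0; rewrite /trunc_expR; case: ifPn => [h|_].
  by rewrite ler_expR (le_trans (ler_norm _)).
by rewrite -expR0 ler_expR.
Qed.

(** The pointwise bound has no linear term for [delta <= 1]; for [delta > 1] it has one, whose
    integral vanishes. In both cases only the moment of order [delta] remains. *)
Lemma trunc_expR_moment (X : T -> R) (delta b L : R) : measurable_fun setT X ->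
  0 < delta <= 2 -> (\int[P]_w (`|X w| `^ delta)%:E < +oo)%E ->
  (1 < delta -> ('E_P[X] = 0)%E) -> 1 <= L ->
  (\int[P]_w (trunc_expR b L (X w))%:E <=
   (1 + `|b| `^ delta * fine (\int[P]_w (`|X w| `^ delta)%:E) * expR (2 * L))%:E)%E.
Proof.
move=> mX /andP[d0 d2] Koo EX L1.
have mXd : measurable_fun setT (fun w => `|X w| `^ delta).
  have mN : measurable_fun setT (fun w => `|X w|) by exact: measurableT_comp.
  exact: (measurableT_comp (measurable_powR delta) mN).
have intXd : P.-integrable setT (EFin \o (fun w => `|X w| `^ delta)).
  apply/integrableP; split; first exact/measurable_EFinP.
  apply: le_lt_trans Koo; rewrite le_eqVlt; apply/orP; left; apply/eqP.
  by apply: eq_integral => w _ /=; rewrite ger0_norm// powR_ge0.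
set K := fine _.
have KE : (\int[P]_w (`|X w| `^ delta)%:E)%E = K%:E.
  by rewrite /K fineK// ge0_fin_numE// integral_ge0// => w _; rewrite lee_fin powR_ge0.
have mtr : measurable_fun setT (fun w => trunc_expR b L (X w)).
  exact: (measurableT_comp (measurable_trunc_expR b L) mX).
pose c := `|b| `^ delta * expR (2 * L).
have c0 : 0 <= c by rewrite mulr_ge0 ?powR_ge0 ?expR_ge0.
have powM x : `|b * x| `^ delta * expR (2 * L) = c * `|x| `^ delta.
  by rewrite normrM powRM// /c mulrAC.
have inttr : P.-integrable setT (EFin \o (fun w => trunc_expR b L (X w))).
  apply: (@le_integrable _ _ _ _ _ _ _ (EFin \o cst (expR L))) => //.
  - exact/measurable_EFinP.
  - move=> w _ /=; rewrite lee_fin ger0_norm ?trunc_expR_ge0// ger0_norm ?expR_ge0//.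
    by rewrite trunc_expR_le// (le_trans ler01).
  - exact: finite_measure_integrable_cst.
have intcX : P.-integrable setT (fun w => c%:E * (`|X w| `^ delta)%:E)%E.
  exact: (integrableZl _ _ intXd).
have int1 : P.-integrable setT (EFin \o cst (1 : R)).
  exact: finite_measure_integrable_cst.
have bnd : (1 + `|b| `^ delta * K * expR (2 * L))%:E = (1%:E + c%:E * K%:E)%E.
  by rewrite -EFinM -EFinD /c mulrAC.
have intc : (\int[P]_w (c%:E * (`|X w| `^ delta)%:E) = c%:E * K%:E)%E.
  by rewrite (integralZl _ intXd)// KE.
have [d1|d1] := leP delta 1.
  apply: (@le_trans _ _ (\int[P]_w (1%:E + c%:E * (`|X w| `^ delta)%:E))%E).
    apply: le_integral => //.
      exact: (integrableD _ int1 intcX).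
    move=> w _; rewrite -EFinM -EFinD lee_fin /trunc_expR; case: ifPn => h.
      rewrite -powM; apply: expR_trunc_le => //; exact/andP.
    by rewrite lerDl mulr_ge0// powR_ge0.
  by rewrite (integralD _ int1 intcX)//= integral_prob_cst intc bnd.
have intX : P.-integrable setT (EFin \o X).
  apply: (@le_integrable _ _ _ _ _ _ _ (fun w => 1%:E + 1%:E * (`|X w| `^ delta)%:E)%E) => //.
  - exact/measurable_EFinP.
  - move=> w _ /=; rewrite lee_fin mul1r [leRHS]ger0_norm ?addr_ge0 ?powR_ge0//.
    have [x1|x1] := leP 1 `|X w|.
      by apply: le_trans (le1r_powR x1 (ltW d1)) _; rewrite lerDr.
    by apply: le_trans (ltW x1) _; rewrite lerDl powR_ge0.
  - by apply: (integrableD _ int1) => //; exact: (integrableZl _ _ intXd).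
have intbX : P.-integrable setT (fun w => b%:E * (X w)%:E)%E.
  exact: (integrableZl _ _ intX).
have intb : (\int[P]_w (b%:E * (X w)%:E) = 0)%E.
  rewrite (integralZl _ intX)//; have := EX d1; rewrite unlock => ->.
  by rewrite mule0.
have int1bX : P.-integrable setT (fun w => 1%:E + b%:E * (X w)%:E)%E.
  exact: (integrableD _ int1 intbX).
apply: (@le_trans _ _ (\int[P]_w ((1%:E + b%:E * (X w)%:E) + c%:E * (`|X w| `^ delta)%:E))%E).
  apply: le_integral => //.
    exact: (integrableD _ int1bX intcX).
  move=> w _; rewrite -!EFinM -!EFinD lee_fin -powM /trunc_expR; case: ifPn => h.
    by apply: expR_trunc_le2 => //; exact/andP.
  by apply: one_le_trunc2 => //; rewrite ltNge.
rewrite (integralD _ int1bX intcX)//= (integralD _ int1 intbX)//=.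
by rewrite integral_prob_cst intb adde0 intc bnd.
Qed.

End truncated_exponential.

Section identical_distribution.
Context {R : realType} {d : measure_display} {T : measurableType d}.
Variable P : probability T R.

Lemma identical_ge0_integral (X Y : T -> R) (g : R -> \bar R) :
  measurable_fun setT X -> measurable_fun setT Y ->
  (forall B, measurable B -> P (X @^-1` B) = P (Y @^-1` B)) ->
  measurable_fun setT g -> (forall x, 0 <= g x)%E ->
  (\int[P]_w g (X w) = \int[P]_w g (Y w))%E.
Proof.
move=> mX mY XY mg g0.
have hX := @ge0_integral_pushforward _ _ _ _ _ _ mX P setT g measurableT mg (fun y _ => g0 y).
have hY := @ge0_integral_pushforward _ _ _ _ _ _ mY P setT g measurableT mg (fun y _ => g0 y).
rewrite !preimage_setT in hX hY.
rewrite -[LHS]hX -[RHS]hY; apply: eq_measure_integral => A mA _; exact: XY.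
Qed.

Lemma ge0_integral_mul_indep (U V : T -> R) :
  measurable_fun setT U -> measurable_fun setT V ->
  (forall w, 0 <= U w) -> (forall w, 0 <= V w) ->
  (forall A B : set R, measurable A -> measurable B ->
    P (U @^-1` A `&` V @^-1` B) = (P (U @^-1` A) * P (V @^-1` B))%E) ->
  (\int[P]_w (U w * V w)%:E = \int[P]_w (U w)%:E * \int[P]_w (V w)%:E)%E.
Proof.
move=> mU mV.
pose U' : {mfun T >-> R} := HB.pack U (isMeasurableFun.Build _ _ _ _ _ mU).
pose V' : {mfun T >-> R} := HB.pack V (isMeasurableFun.Build _ _ _ _ _ mV).
exact: (@ge0_integral_prod_indep _ _ _ P U' V').
Qed.

End identical_distribution.

(** * Sums and products over blocks of an iid family *)

Section iid_sums.
Context {R : realType} {d : measure_display} {T : measurableType d}.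
Variable P : probability T R.
Implicit Types (X : int -> T -> R) (I J : set int).

Lemma family_sigma_algebra X I : sigma_algebra setT (family_sigma X I).
Proof. exact: smallest_sigma_algebra. Qed.

Lemma measurable_wrt_family X I s : (forall i, measurable_fun setT (X i)) -> I s ->
  measurable_wrt (family_sigma X I) (X s).
Proof.
move=> mX Is; apply/(measurable_wrtP _ (family_sigma_algebra X I)) => B mB.
by apply: sub_sigma_algebra; exists s, B.
Qed.

Lemma measurable_wrt_measurable (G : set (set T)) (U : T -> R) :
  sigma_algebra setT G -> G `<=` measurable ->
  measurable_wrt G U -> measurable_fun setT U.
Proof.
move=> sG Gm /(measurable_wrtP _ sG) mU _ B mB; rewrite setTI; exact/Gm/mU.
Qed.

Lemma measurable_wrt_sub (G H : set (set T)) (U : T -> R) :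
  sigma_algebra setT G -> sigma_algebra setT H -> G `<=` H ->
  measurable_wrt G U -> measurable_wrt H U.
Proof.
move=> sG sH GH /(measurable_wrtP _ sG) mU; apply/(measurable_wrtP _ sH) => B mB.
exact/GH/mU.
Qed.

Lemma iid_indep_preimage X I J (U V : T -> R) : iid P X -> I `&` J = set0 ->
  measurable_wrt (family_sigma X I) U -> measurable_wrt (family_sigma X J) V ->
  forall A B : set R, measurable A -> measurable B ->
  P (U @^-1` A `&` V @^-1` B) = (P (U @^-1` A) * P (V @^-1` B))%E.
Proof.
move=> iidX IJ /(measurable_wrtP _ (family_sigma_algebra X I)) mU.
move=> /(measurable_wrtP _ (family_sigma_algebra X J)) mV A B mA mB.
by apply: (iid_indep iidX IJ); [exact: mU|exact: mV].
Qed.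

Definition window (t : int) (n m : nat) : set int :=
  [set s | exists2 j, (n <= j < m)%N & s = t - j%:Z].

Lemma window_disjoint t n m k l : (m <= k)%N -> window t n m `&` window t k l = set0.
Proof.
move=> mk; apply/seteqP; split => // s [[i /andP[_ im] ->] [j /andP[kj _]]].
move=> /addrI/oppr_inj[ij]; move: im; rewrite ij ltnNge.
by rewrite (leq_trans mk kj).
Qed.

Lemma window_shift t n m (k : nat) : (n <= k < m)%N -> window t n m (t - k%:Z).
Proof. by exists k. Qed.

Lemma windowS t n m k l : (k <= n)%N -> (m <= l)%N -> window t n m `<=` window t k l.
Proof.
move=> kn ml s [j /andP[nj jm] ->]; exists j => //.
by rewrite (leq_trans kn nj) (leq_trans jm ml).
Qed.

Lemma measurable_wrt_window_sum X (a : nat -> R) t n m :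
  (forall i, measurable_fun setT (X i)) ->
  measurable_wrt (family_sigma X (window t n m))
    (fun w => \sum_(n <= j < m) a j * X (t - j%:Z) w).
Proof.
move=> mX.
(* [measurable_sum] asks for measurability of the summand at every index, so terms outside the range
   are set to 0. *)
rewrite (_ : (fun _ => _) = (fun w => \sum_(j <- index_iota n m)
    (if (n <= j < m)%N then a j * X (t - j%:Z) w else 0))); last first.
  by apply/funext => w; rewrite [LHS]big_seq [RHS]big_seq; apply: eq_bigr => j; rewrite mem_index_iota => ->.
apply: measurable_sum => j; case jnm : (n <= j < m)%N; last exact: measurable_cst.
apply: measurable_funM; first exact: measurable_cst.
apply: (@measurable_wrt_family X) => //; exact: window_shift.
Qed.

Lemma measurable_wrt_window_prod X (g : nat -> R -> R) t n m :
  (forall i, measurable_fun setT (X i)) ->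
  (forall j, measurable_fun setT (g j)) ->
  measurable_wrt (family_sigma X (window t n m))
    (fun w => \prod_(n <= j < m) g j (X (t - j%:Z) w)).
Proof.
move=> mX mg.
rewrite (_ : (fun _ => _) = (fun w => \prod_(j <- index_iota n m)
    (if (n <= j < m)%N then g j (X (t - j%:Z) w) else 1))); last first.
  by apply/funext => w; rewrite [LHS]big_seq [RHS]big_seq; apply: eq_bigr => j; rewrite mem_index_iota => ->.
apply: measurable_prod => j _; case jnm : (n <= j < m)%N; last exact: measurable_cst.
apply: (measurableT_comp (mg j)).
by apply: measurable_wrt_family => //; exact: window_shift.
Qed.

(** Induction on [m]: the last factor lives on a window disjoint from the previous ones, hence is
    independent of their product. *)
Lemma integral_window_prod_le X (g : nat -> R -> R) (B : nat -> R) t n m :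
  iid P X -> (forall j, measurable_fun setT (g j)) ->
  (forall j x, 0 <= g j x) -> (forall j, 0 <= B j) ->
  (forall j, (\int[P]_w (g j (X (t - j%:Z) w))%:E <= (B j)%:E)%E) ->
  (\int[P]_w (\prod_(n <= j < m) g j (X (t - j%:Z) w))%:E <=
    (\prod_(n <= j < m) B j)%:E)%E.
Proof.
move=> iidX mg g0 B0 gB; have mX := iidX.1.
elim: m => [|m IH].
  rewrite big_geq//; under eq_integral do rewrite big_geq//.
  by rewrite integral_prob_cst.
have [mn|nm] := ltnP m n.
  rewrite big_geq//; under eq_integral do rewrite big_geq//.
  by rewrite integral_prob_cst.
rewrite big_nat_recr//=; under eq_integral do rewrite big_nat_recr//=.
have mU := @measurable_wrt_window_prod X g t n m mX mg.
have mV : measurable_wrt (family_sigma X (window t m m.+1)) (fun w => g m (X (t - m%:Z) w)).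
  apply: (measurableT_comp (mg m)); apply: measurable_wrt_family => //.
  by apply: window_shift; rewrite leqnn ltnSn.
rewrite ge0_integral_mul_indep.
- rewrite EFinM; apply: lee_pmul => //.
  + by apply: integral_ge0 => w _; rewrite lee_fin prodr_ge0.
  + by apply: integral_ge0 => w _; rewrite lee_fin.
- apply: measurable_wrt_measurable mU; first exact: family_sigma_algebra.
  exact: family_sigma_measurable.
- apply: measurable_wrt_measurable mV; first exact: family_sigma_algebra.
  exact: family_sigma_measurable.
- by move=> w; rewrite prodr_ge0.
- by move=> w.
- by apply: (iid_indep_preimage iidX _ mU mV); exact: window_disjoint.
Qed.

(** Unless some scaled summand exceeds [L] in absolute value, the exponential of [s] times the sum
    is the product [W] of truncated exponentials. A union bound pays for the exceptions, Markov's
    inequality for [W] gives the second term, and [1 + y <= expR y] turns the product of moment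
    bounds into the exponential of a sum. *)
Lemma chernoff_window X (a : nat -> R) (t : int) (n m : nat) (delta s L x : R) :
  iid P X -> 0 < delta <= 2 -> (\int[P]_w (`|X 0%R w| `^ delta)%:E < +oo)%E ->
  (1 < delta -> ('E_P[X 0%R] = 0)%E) -> 1 <= L -> 0 < s ->
  pr P [set w | x < \sum_(n <= j < m) a j * X (t - j%:Z) w] <=
  \sum_(n <= j < m) pr P [set w | L < `|s * a j * X (t - j%:Z) w|] +
  expR (- (s * x) + \sum_(n <= j < m) (`|a j| `^ delta) *
     (s `^ delta * fine (\int[P]_w (`|X 0%R w| `^ delta)%:E) * expR (2 * L))).
Proof.
move=> iidX dd Koo EX L1 s0; have mX := iidX.1.
set K := fine _.
have K0 : 0 <= K by rewrite /K fine_ge0// integral_ge0// => w _; rewrite lee_fin powR_ge0.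
pose g j := trunc_expR (s * a j) L.
have mg j : measurable_fun setT (g j) by exact: measurable_trunc_expR.
have g0 j y : 0 <= g j y by exact: trunc_expR_ge0.
pose c := s `^ delta * K * expR (2 * L).
pose W w := \prod_(n <= j < m) g j (X (t - j%:Z) w).
pose S w := \sum_(n <= j < m) a j * X (t - j%:Z) w.
pose A j := [set w | L < `|s * a j * X (t - j%:Z) w|].
have mA j : measurable (A j).
  apply: measurable_abs_gt; apply: measurable_funM; [exact: measurable_cst|exact: mX].
have mS : measurable_fun setT S.
  exact: (measurable_wrt_measurable (family_sigma_algebra X _)
    (family_sigma_measurable mX) (@measurable_wrt_window_sum X a t n m mX)).
have mW : measurable_fun setT W.
  exact: (measurable_wrt_measurable (family_sigma_algebra X _)
    (family_sigma_measurable mX) (@measurable_wrt_window_prod X g t n m mX mg)).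
have W0 w : 0 <= W w by exact: prodr_ge0.
pose E := [set w | ((expR (s * x))%:E <= `|(W w)%:E|)%E].
have mE : measurable E.
  rewrite /E -[X in measurable X]setTI; apply: emeasurable_fun_c_infty => //.
  by apply: measurableT_comp => //; exact/measurable_EFinP.
have mUA : measurable (\big[setU/set0]_(j <- index_iota n m) A j).
  exact: bigsetU_measurable.
have WB : (\int[P]_w (W w)%:E <=
    (expR (\sum_(n <= j < m) `|a j| `^ delta * c))%:E)%E.
  have h := @integral_window_prod_le X g (fun j => expR (`|a j| `^ delta * c)) t n m iidX mg g0.
  apply: le_trans (h _ _) _ => [j|j|]; first exact: expR_ge0.
    have e : (\int[P]_w (g j (X (t - j%:Z) w))%:E = \int[P]_w (g j (X 0%R w))%:E)%E.
      apply: (identical_ge0_integral (g := fun y => (g j y)%:E)) => //.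
      + by move=> B mB; exact: iidX.2.2.
      + exact/measurable_EFinP.
      + by move=> y; rewrite lee_fin.
    rewrite e; apply: le_trans (trunc_expR_moment _ (mX 0) dd Koo EX L1) _.
    rewrite lee_fin; apply: le_trans (expR_ge1Dx _).
    rewrite lerD2l -/K /c normrM (gtr0_norm s0) powRM ?(ltW s0)//.
    by rewrite le_eqVlt; apply/orP; left; apply/eqP; ring.
  by rewrite lee_fin expR_sum.
have PE : pr P E <= expR (- (s * x) + \sum_(n <= j < m) `|a j| `^ delta * c).
  have hE : ((expR (s * x))%:E * P E <= \int[P]_w `|(W w)%:E|)%E.
    rewrite -[E]setTI; apply: le_integral_abse => //; last exact: expR_gt0.
    exact/measurable_EFinP.
  have eW : (\int[P]_w `|(W w)%:E| = \int[P]_w (W w)%:E)%E.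
    by apply: eq_integral => w _; rewrite /= ger0_norm.
  rewrite eW in hE; have := le_trans hE WB.
  rewrite -(prE P mE) -EFinM lee_fin expRD expRN => h.
  by rewrite -ler_pdivrMl ?invr_gt0 ?expR_gt0// invrK.
apply: (@le_trans _ _ (pr P (\big[setU/set0]_(j <- index_iota n m) A j `|` E))).
  apply: pr_le; [exact: measurable_gt|exact: measurableU|].
  move=> w /= xS.
  have [UA|nUA] := pselect ((\big[setU/set0]_(j <- index_iota n m) A j) w); first by left.
  right; rewrite /E/= ger0_norm//.
  have -> : W w = expR (s * S w).
    rewrite /W /S mulr_sumr expR_sum big_nat_cond [RHS]big_nat_cond.
    apply: eq_bigr => j; rewrite andbT => jnm; rewrite /g /trunc_expR.
    rewrite mulrA ifT// leNgt; apply/negP => h; apply: nUA.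
    by rewrite -bigcup_seq; exists j => //=; rewrite mem_index_iota.
  by rewrite lee_fin ler_expR ler_wpM2l ?(ltW s0)// ltW.
apply: le_trans (prU_le P mUA mE) _; apply: lerD => //.
exact: pr_bigU_le.
Qed.

End iid_sums.

Section tail_bound.
Context {R : realType} {d : measure_display} {T : measurableType d}.
Variable P : probability T R.
Implicit Types (X : int -> T -> R).

Lemma powRN_small (C e g : R) : 0 < C -> 0 < e -> 0 < g ->
  exists2 x0, 0 < x0 & forall x, x0 <= x -> C * x `^ (- g) <= e.
Proof.
move=> C0 e0 g0; have q0 : 0 < C / e by rewrite divr_gt0.
exists ((C / e) `^ g^-1); first exact: powR_gt0.
move=> x hx; have x0 : 0 < x by apply: lt_le_trans hx; exact: powR_gt0.
rewrite powRN ler_pdivrMr ?powR_gt0// mulrC -ler_pdivrMr//.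
have -> : C / e = ((C / e) `^ g^-1) `^ g by rewrite -powRrM mulVf ?gt_eqF// powRr1// ltW.
apply: ge0_ler_powR => //; first exact: ltW.
- by rewrite nnegrE powR_ge0.
- by rewrite nnegrE ltW.
Qed.

(** The fourth root is small enough for the balance of powers in [window_tail_upper]: it bounds [s]
    by a multiple of x to the power -3/4. *)
Lemma ln_le_powR (x : R) : 0 < x -> ln x <= 4 * x `^ (4^-1).
Proof.
move=> x0; have : ln (x `^ 4^-1) <= x `^ 4^-1.
  have h : 0 < x `^ 4^-1 by exact: powR_gt0.
  by have := le_expR_self (ln (x `^ 4^-1)); rewrite lnK// posrE.
by rewrite ln_powR ler_pdivrMl.
Qed.

Lemma identical_abs_tail X : iid P X -> forall i x, abs_tail P (X i) x = abs_tail P (X 0%R) x.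
Proof.
move=> iidX i x; have h := iidX.2.2 i [set y | x < `|y|].
congr fine; apply: h.
have := @measurable_abs_gt _ _ _ (fun y : R => y) x; apply; exact: measurable_id.
Qed.

(** The threshold [x1] sees the coefficients only through [A] and [M], never through the window;
    this allows [m] to tend to infinity later. The condition [M * |a j| <= 1] makes the ratio [u] in
    Potter's bound at least 1. *)
Lemma window_tail_upper X (t : int) (alpha delta A : R) (M : nat) :
  iid P X -> regularly_varying_fun (abs_tail P (X 0%R)) (- alpha) ->
  0 < delta < alpha -> delta <= 2 -> (1 < delta -> ('E_P[X 0%R] = 0)%E) ->
  0 < A -> 4 * alpha < M%:R * delta ->
  forall eta, 0 < eta -> exists2 x1 : R, 0 < x1 & forall x, x1 <= x ->
  forall (a : nat -> R) (n m : nat),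
  (forall j, (n <= j < m)%N -> M%:R * `|a j| <= 1) ->
  \sum_(n <= j < m) `|a j| `^ delta <= A ->
  pr P [set w | x < \sum_(n <= j < m) a j * X (t - j%:Z) w] <=
  (2 `^ delta * M%:R `^ delta * (\sum_(n <= j < m) `|a j| `^ delta) + eta) *
     abs_tail P (X 0%R) x.
Proof.
move=> iidX rv da d2 EX A0 aM eta eta0; have mX := iidX.1.
set f := abs_tail P (X 0%R).
have [d0 dal] := andP da.
have a0 : 0 < alpha by exact: lt_trans dal.
have M0 : 0 < M%:R :> R.
  rewrite ltr0n lt0n; apply/negP => /eqP M0; move: aM.
  by rewrite M0 mul0r pmulr_rlt0// ltNge (ltW a0).
have fmono := abs_tail_noninc P (mX 0%R).
have Koo := moment_finite (mX 0%R) rv da.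
set K := fine (\int[P]_w (`|X 0%R w| `^ delta)%:E).
have K0 : 0 <= K by rewrite /K fine_ge0// integral_ge0// => w _; rewrite lee_fin powR_ge0.
have [xu xu0 [fpos fu]] := potter_upper rv fmono da.
(* Midway between [alpha] and [M delta / 4]: above [alpha] for the lower Potter bound on [f], below
   [M delta / 4] so that a negative power of [x] is left over to produce [eta]. *)
pose beta := (alpha + M%:R * delta / 4) / 2.
have b1 : alpha < beta by rewrite /beta; lra.
have b2 : 0 < M%:R * delta / 4 - beta by rewrite /beta; lra.
have ab : 0 < alpha < beta by rewrite a0.
have [xl xl0 [c c0 fl]] := potter_lower rv fmono ab.
have [xs xs0 hs] := @powRN_small (expR 1) (eta * c) _ (expR_gt0 1) (mulr_gt0 eta0 c0) b2.
pose C := A * ((delta * M%:R) `^ delta * (K + 1)).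
have C0 : 0 < C.
  by rewrite !mulr_gt0 ?powR_gt0 ?mulr_gt0// ltr_wpDl.
have d4 : 0 < delta / 4 by rewrite divr_gt0.
have [xc xc0 hc] := @powRN_small C 1 (delta / 4) C0 ltr01 d4.
exists (Num.max (Num.max xu xl) (Num.max (Num.max xs xc) (expR (4 / delta)))).
  by rewrite !lt_max xu0.
move=> x; rewrite !ge_max => /andP[/andP[xux xlx] /andP[/andP[xsx xcx] xex]].
move=> a n m aj sA.
have x0 : 0 < x by exact: lt_le_trans xux.
have [L LE] : exists L, L = delta / 4 * ln x by exists (delta / 4 * ln x).
have L1 : 1 <= L.
  rewrite LE -ler_pdivrMl// mulr1 invf_div -(expRK (4 / delta)).
  by rewrite ler_ln ?posrE ?expR_gt0.
have L0 : 0 < L by exact: lt_le_trans L1.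
(* With this scale a summand exceeds the level exactly when [|a j X| > x / M], and [s * x = L * M]
   makes [expR (- (s * x))] equal to x to the power [- M delta / 4]. *)
have [s sE] : exists s, s = L * M%:R / x by exists (L * M%:R / x).
have s0 : 0 < s by rewrite sE; exact: divr_gt0 (mulr_gt0 L0 M0) x0.
have dd : 0 < delta <= 2 by rewrite d0.
apply: le_trans (@chernoff_window _ _ _ P X a t n m delta s L x iidX dd Koo EX L1 s0) _.
rewrite -/K [leRHS]mulrDl; apply: lerD.
  apply: (@le_trans _ _ (\sum_(n <= j < m) 2 `^ delta * M%:R `^ delta * `|a j| `^ delta * f x));
    last by rewrite -mulr_suml -mulr_sumr.
  rewrite [leLHS]big_nat_cond [leRHS]big_nat_cond; apply: ler_sum => j.
  rewrite andbT => jnm.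
  have [aj0|aj0] := eqVneq (a j) 0.
    rewrite (_ : [set _ | _] = set0); last first.
      apply/seteqP; split => w //=.
      by rewrite aj0 mulr0 mul0r normr0 ltNge (ltW L0).
    by rewrite /pr measure0/= !mulr_ge0 ?powR_ge0 ?pr_ge0.
  have na0 : 0 < `|a j| by rewrite normr_gt0.
  pose u := (M%:R * `|a j|)^-1.
  have u0 : 0 < u by rewrite invr_gt0 mulr_gt0.
  have u1 : 1 <= u by rewrite /u invf_ge1 ?mulr_gt0// aj.
  have -> : pr P [set w | L < `|s * a j * X (t - j%:Z) w|] = f (u * x).
    rewrite /f -(identical_abs_tail iidX (t - j%:Z)) /abs_tail; congr (fine (P _)).
    have e : s * `|a j| = L / (u * x).
      by rewrite sE /u; field; rewrite !gt_eqF.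
    by apply/seteqP; split => w /=; rewrite !normrM (gtr0_norm s0) e mulrAC
      ltr_pdivlMr ?mulr_gt0// ltr_pM2l.
  apply: le_trans (fu x u xux u1) _.
  rewrite ler_wpM2r ?pr_ge0// -mulrA ler_wpM2l ?powR_ge0//.
  rewrite -powRM ?(ltW M0)// powRN -/u -[M%:R * _]invrK -/u.
  by rewrite -(powR_inv1 (ltW u0)) -powRrM mulN1r powRN.
have eL : expR (2 * L) = x `^ (delta / 2).
  by rewrite /powR gt_eqF// LE; congr expR; field.
have xd1 : 0 < x `^ (- (3 / 4)) by exact: powR_gt0.
have sle : s <= delta * M%:R * x `^ (- (3 / 4)).
  rewrite sE ler_pdivrMr//.
  have e34 : x `^ (- (3 / 4)) * x = x `^ 4^-1.
    rewrite -{2}(powRr1 (ltW x0)) -powRD ?(gt_eqF x0) ?implybT//.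
    by congr (_ `^ _); field.
  rewrite -[leRHS]mulrA e34.
  have := ler_wpM2l (ltW d4) (ln_le_powR x0); rewrite -LE => hL.
  have := ler_wpM2r (ltW M0) hL.
  have -> : delta / 4 * (4 * x `^ 4^-1) * M%:R = delta * M%:R * x `^ 4^-1 by field.
  by [].
have sd : s `^ delta <= (delta * M%:R) `^ delta * x `^ (- (3 / 4) * delta).
  rewrite [_ `^ (_ * _)]powRrM -powRM ?mulr_ge0 ?(ltW d0) ?(ltW M0) ?(ltW xd1)//.
  apply: ge0_ler_powR => //; rewrite ?nnegrE ?(ltW d0) ?(ltW s0)//.
  by rewrite !mulr_ge0 ?(ltW d0) ?(ltW M0) ?(ltW xd1).
(* The powers of [x] add up to -3 delta / 4 + delta / 2 = - delta / 4, so the moment part of the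
   exponent is at most 1 and costs only the factor [expR 1]. *)
have le1 : (\sum_(n <= j < m) `|a j| `^ delta) * (s `^ delta * K * expR (2 * L)) <= 1.
  apply: le_trans (hc x xcx).
  rewrite /C -[leRHS]mulrA; apply: ler_pM => //.
  - by apply: sumr_ge0 => j _; exact: powR_ge0.
  - by rewrite !mulr_ge0 ?powR_ge0 ?expR_ge0.
  rewrite eL.
  have -> : x `^ (- (delta / 4)) = x `^ (- (3 / 4) * delta) * x `^ (delta / 2).
    by rewrite -powRD ?(gt_eqF x0) ?implybT//; congr (_ `^ _); field.
  rewrite mulrA ler_wpM2r ?powR_ge0//.
  rewrite [leRHS]mulrAC; apply: ler_pM; rewrite ?powR_ge0//.
  by rewrite lerDl.
apply: (@le_trans _ _ (expR (- (s * x) + 1))).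
  rewrite ler_expR lerD2l -mulr_suml; exact: le1.
have -> : - (s * x) + 1 = 1 + (- (M%:R * delta / 4)) * ln x.
  by rewrite sE divfK ?gt_eqF// LE; field.
have -> : expR (1 + (- (M%:R * delta / 4)) * ln x) =
    expR 1 * x `^ (- (M%:R * delta / 4 - beta)) * x `^ (- beta).
  rewrite expRD -[RHS]mulrA -powRD ?(gt_eqF x0) ?implybT//.
  congr (_ * _); rewrite /powR gt_eqF//; congr (expR (_ * _)).
  by rewrite opprB addrAC subrr add0r.
apply: le_trans (ler_wpM2r (powR_ge0 _ _) (hs x xsx)) _.
by rewrite -mulrA ler_wpM2l ?(ltW eta0)// fl.
Qed.

End tail_bound.

(** * Tails of linear processes *)

Section tails.
Context {R : realType} {d : measure_display} {T : measurableType d}.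
Variable P : probability T R.
Implicit Types (X : int -> T -> R) (U V : T -> R).

(** Fatou's lemma for events: [E] lies almost surely in the increasing union of the [B k], and each
    [B k] is inside [A k]. It carries uniform bounds from partial sums to their almost sure
    limit. *)
Lemma pr_le_ae_eventually (A : nat -> set T) (E : set T) (c : R) :
  (forall n, measurable (A n)) -> measurable E -> (forall n, pr P (A n) <= c) ->
  {ae P, forall w, E w -> \forall n \near \oo, A n w} -> pr P E <= c.
Proof.
move=> mA mE Ac EA.
pose B k := \bigcap_(n in [set n | (k <= n)%N]) A n.
have mB k : measurable (B k) by apply: bigcap_measurable => //; exists k => /=.
have mUB : measurable (\bigcup_k B k) by exact: bigcupT_measurable.
have BP : (P \o B) @ \oo --> P (\bigcup_k B k).
  apply: nondecreasing_cvg_mu => // m n mn; apply/subsetPset => w Bw k /= nk.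
  by apply: Bw => /=; exact: leq_trans nk.
have PUB : pr P (\bigcup_k B k) <= c.
  rewrite -lee_fin prE// -(cvg_lim _ BP)//; apply: lime_le.
    by apply/cvg_ex; eexists; exact: BP.
  apply: nearW => k; rewrite /= -prE// lee_fin; apply: le_trans (Ac k).
  by apply: pr_le => // w; apply => /=.
have [N [mN N0 EN]] := EA.
apply: (@le_trans _ _ (pr P (\bigcup_k B k `|` N))).
  apply: pr_le => //; first exact: measurableU.
  move=> w Ew; have [Nw|Nw] := pselect (N w); [by right|left].
  have [k _ hk] : \forall n \near \oo, A n w.
    by apply: contrapT => h; apply: Nw; apply: EN => /= /(_ Ew).
  by exists k.
apply: le_trans (prU_le P mUB mN) _.
by rewrite [X in _ + X]/pr N0 addr0.
Qed.

Lemma right_tail_ge0 U x : 0 <= right_tail P U x.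
Proof. exact: pr_ge0. Qed.

Lemma right_tail_noninc U : measurable_fun setT U ->
  {homo right_tail P U : x y / x <= y >-> y <= x}.
Proof.
move=> mU x y xy; apply: pr_le; [exact: measurable_gt|exact: measurable_gt|].
by move=> w /=; exact: le_lt_trans.
Qed.

Lemma right_tail_cvg0 U : measurable_fun setT U -> right_tail P U @ +oo --> 0.
Proof.
move=> mU; pose U' : {mfun T >-> R} := HB.pack U (isMeasurableFun.Build _ _ _ _ _ mU).
have h := @cvg_ccdfy0 _ _ _ P U'.
have -> : right_tail P U = fine \o @ccdf _ _ _ P U'.
  apply/funext => x; congr (fine (P _)); apply/seteqP; split => w /=;
    by rewrite in_itv/= andbT.
exact: (fine_cvg h).
Qed.

Lemma abs_tail_cvg0 U : measurable_fun setT U -> abs_tail P U @ +oo --> 0.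
Proof.
move=> mU; apply: (@right_tail_cvg0 (fun w => `|U w|)).
exact: measurableT_comp.
Qed.

(** Above: if neither summand exceeds [k x] with [k = 1 / t], then [U + V > x] forces both beyond
    [(1 - k) x], which by independence is negligible against [f x]. Below: one summand exceeds [t x]
    while the other stays within [(t - 1) x]; the two such events are disjoint for [x > 0]. *)
Lemma right_tail_add (alpha c1 c2 : R) (f : R -> R) U V :
  regularly_varying_fun f (- alpha) ->
  measurable_fun setT U -> measurable_fun setT V ->
  (forall A B : set R, measurable A -> measurable B ->
    P (U @^-1` A `&` V @^-1` B) = (P (U @^-1` A) * P (V @^-1` B))%E) ->
  (fun x => right_tail P U x / f x) @ +oo --> c1 ->
  (fun x => right_tail P V x / f x) @ +oo --> c2 ->
  (fun x => right_tail P (fun w => U w + V w) x / f x) @ +oo --> c1 + c2.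
Proof.
move=> rv mU mV ind Uc Vc.
have mUV : measurable_fun setT (fun w => U w + V w) by exact: measurable_funD.
have prep (W : T -> R) (B : set R) : measurable_fun setT W -> measurable B -> measurable (W @^-1` B).
  by move=> mW mB; rewrite -[X in measurable X]setTI; exact: mW.
have prI A B : measurable A -> measurable B ->
    pr P (U @^-1` A `&` V @^-1` B) = pr P (U @^-1` A) * pr P (V @^-1` B).
  by move=> mA mB; apply: prI_indep; [exact: prep|exact: prep|exact: ind].
have gtE (W : T -> R) y : [set w | y < W w] = W @^-1` `]y, +oo[.
  by apply/seteqP; split => w /=; rewrite in_itv/= andbT.
have absE (W : T -> R) y : ~` [set w | y < `|W w|] = W @^-1` `[- y, y].
  apply/seteqP; split => w /=; rewrite in_itv/= -ler_norml.
    by move/negP; rewrite -leNgt.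
  by move=> h; apply/negP; rewrite -leNgt.
apply: (@cvg_squeeze_family _ _ _ _ _ (fun t => (c1 + c2) * t `^ alpha)
  (fun t => (c1 + c2) * t `^ (- alpha))).
- move=> t t1; have t0 : 0 < t by exact: lt_trans t1.
  pose k := t^-1; pose th := 1 - t^-1.
  have k0 : 0 < k by rewrite invr_gt0.
  have th0 : 0 < th by rewrite subr_gt0 invf_lt1.
  exists (fun x => right_tail P U (k * x) / f x + right_tail P V (k * x) / f x +
    right_tail P U (th * x) / f x * right_tail P V (th * x)).
  exists (c1 * k `^ (- alpha) + c2 * k `^ (- alpha) + c1 * th `^ (- alpha) * 0); split.
  + near=> x.
    have fx : 0 < f x by near: x; exact: rv.1.
    rewrite mulrAC -!mulrDl ler_pM2r ?invr_gt0//.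
    rewrite /right_tail -/(pr P _) -!/(pr P [set w | _]).
    rewrite [X in _ + X](_ : _ = pr P ([set w | th * x < U w] `&` [set w | th * x < V w])); last first.
      by rewrite !gtE prI//; exact: measurable_itv.
    pose A1 := [set w | k * x < U w]; pose A2 := [set w | k * x < V w].
    pose A3 := [set w | th * x < U w] `&` [set w | th * x < V w].
    have mA1 : measurable A1 by exact: measurable_gt.
    have mA2 : measurable A2 by exact: measurable_gt.
    have mA3 : measurable A3 by apply: measurableI; exact: measurable_gt.
    have mA12 : measurable (A1 `|` A2) by exact: measurableU.
    have l12 := prU_le P mA1 mA2; have l123 := prU_le P mA12 mA3.
    apply: le_trans; last by apply: lerD; [exact: l12|exact: lexx].
    apply: le_trans l123; apply: pr_le; [exact: measurable_gt|exact: measurableU|].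
    move=> w /= xUV.
    have thk : th * x = x - k * x by rewrite /th /k; ring.
    have [h1|h1] := ltP (k * x) (U w); first by left; left.
    have [h2|h2] := ltP (k * x) (V w); first by left; right.
    right; split => /=; rewrite thk; clear -xUV h1 h2; lra.
  + apply: cvgD; [apply: cvgD; exact: tail_scale|].
    apply: cvgM; first exact: tail_scale.
    exact: cvg_pinfty_scale th0 (right_tail_cvg0 mV).
  + rewrite mulr0 addr0 -mulrDl /k -powR_inv1 ?(ltW t0)// -powRrM mulrN mulN1r opprK.
    by [].
- move=> t t1; have t0 : 0 < t by exact: lt_trans t1.
  have s0 : 0 < t - 1 by rewrite subr_gt0.
  exists (fun x => right_tail P U (t * x) / f x * (1 - abs_tail P V ((t - 1) * x)) +
     right_tail P V (t * x) / f x * (1 - abs_tail P U ((t - 1) * x))).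
  exists (c1 * t `^ (- alpha) * (1 - 0) + c2 * t `^ (- alpha) * (1 - 0)); split.
  + near=> x.
    have fx : 0 < f x by near: x; exact: rv.1.
    have x0 : 0 < x by near: x; exact: nbhs_pinfty_gt.
    rewrite !(mulrAC _ (f x)^-1) -mulrDl ler_pM2r ?invr_gt0//.
    have mabs (W : T -> R) y : measurable_fun setT W -> measurable [set w | y < `|W w|] by exact: measurable_abs_gt.
    rewrite /right_tail /abs_tail -!/(pr P [set w | _]).
    rewrite -!prC; [|exact: mabs..].
    rewrite !absE !gtE -prI; [|exact: measurable_itv..].
    rewrite [X in _ + X]mulrC -prI; [|exact: measurable_itv..].
    rewrite -prU; last 3 first.
    * by apply: measurableI; apply: prep => //; exact: measurable_itv.
    * by apply: measurableI; apply: prep => //; exact: measurable_itv.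
    * apply/seteqP; split => // w [] /= [] h1 h2 [] h3 h4; move: h1 h2 h3 h4.
      rewrite !in_itv/= !andbT => h1 /andP[h2 h3] /andP[h4 h5] h6; nra.
    apply: pr_le.
    * by apply: measurableU; apply: measurableI; apply: prep => //; exact: measurable_itv.
    * by apply: prep => //; exact: measurable_itv.
    * move=> w [[]|[]] /=; rewrite !in_itv/= !andbT.
        by move=> h1 /andP[h2 _]; lra.
      by move=> /andP[h2 _] h1; lra.
  + have h (W : T -> R) : measurable_fun setT W ->
        (fun x => 1 - abs_tail P W ((t - 1) * x)) @ +oo --> (1 - 0 : R).
      move=> mW; apply: cvgB; first exact: cvg_cst.
      exact: (cvg_pinfty_scale s0 (abs_tail_cvg0 mW)).
    by apply: cvgD; (apply: cvgM; [exact: tail_scale|exact: h]).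
  + by rewrite subr0 !mulr1 mulrDl.
- exact: powR_cvg_at1.
- exact: powR_cvg_at1.
Unshelve. all: by end_near. Qed.

End tails.

(** * Summability of the coefficients *)

Section nonneg_series.
Context {R : realType}.
Implicit Types (u : nat -> R).

Lemma series_partial_le u (l : R) : (forall j, 0 <= u j) -> series u @ \oo --> l ->
  forall n, series u n <= l.
Proof.
move=> u0 ul n; rewrite -(cvg_lim _ ul)//.
apply: nondecreasing_cvgn_le; last by apply/cvg_ex; exists l.
exact: nondecreasing_series.
Qed.

Lemma series_tail_small u (l : R) : (forall j, 0 <= u j) -> series u @ \oo --> l ->
  forall e, 0 < e -> exists N0, forall N, (N0 <= N)%N ->
  l - e < series u N /\ forall m, \sum_(N <= j < m) u j <= e.
Proof.
move=> u0 ul e e0.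
have [N0 _ hN0] : \forall n \near \oo, l - e < series u n.
  by apply: (cvgr_gt _ ul); rewrite gtrBl.
exists N0 => N NN0; have hN := hN0 N NN0; split => // m.
have [mN|Nm] := leqP m N; first by rewrite big_geq// ltW.
have hm := series_partial_le u0 ul m.
rewrite -(sub_series_geq _ (ltnW Nm)) lerBlDr.
apply: le_trans hm _; rewrite -lerBlDl; exact: ltW.
Qed.

Lemma kappa_plus_ge0 (pe x : R) : 0 <= pe <= 1 -> 0 <= kappa_plus pe x <= 1.
Proof.
move=> /andP[p0 p1]; rewrite /kappa_plus; case: ifP => _; first by rewrite p0.
by case: ifP => _; rewrite ?lexx ?ler01// subr_ge0 p1 gerBl.
Qed.

(** Each term of the [delta]-series is at most its sum [l], so the surplus exponent [alpha - delta]
    costs only the constant [B]. *)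
Lemma kappa_series_cvg (pe alpha : R) (a : nat -> R) : 0 <= pe <= 1 ->
  C_alpha alpha a -> cvgn (series (fun j => kappa_plus pe (a j) * `|a j| `^ alpha)).
Proof.
move=> pe01 [delta [/andP[d0 da] [_ [l al]]]].
pose B := l `^ ((alpha - delta) / delta).
have ul j : `|a j| `^ delta <= l.
  have := series_partial_le (fun j => powR_ge0 `|a j| delta) al j.+1.
  apply: le_trans; rewrite /series/= big_nat_recr//= lerDr.
  by apply: sumr_ge0 => i _; exact: powR_ge0.
apply: (@series_le_cvg _ _ (fun j => B * `|a j| `^ delta)).
- by move=> j; have /andP[k0 _] := kappa_plus_ge0 (a j) pe01; rewrite mulr_ge0// powR_ge0.
- by move=> j; rewrite mulr_ge0 ?powR_ge0.
- move=> j; have /andP[k0 k1] := kappa_plus_ge0 (a j) pe01.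
  apply: (@le_trans _ _ (`|a j| `^ alpha)); first by rewrite ler_piMl// powR_ge0.
  have -> : `|a j| `^ alpha = `|a j| `^ (alpha - delta) * `|a j| `^ delta.
    rewrite -powRD ?subrK//; apply/implyP => /eqP h; move: (lt_trans d0 da); rewrite h ltxx.
    by [].
  rewrite ler_wpM2r ?powR_ge0// /B.
  have -> : `|a j| `^ (alpha - delta) = (`|a j| `^ delta) `^ ((alpha - delta) / delta).
    by rewrite -powRrM mulrC divfK// gt_eqF.
  apply: ge0_ler_powR; rewrite ?nnegrE ?powR_ge0//.
    by rewrite divr_ge0 ?subr_ge0 ?(ltW da) ?(ltW d0).
  exact: le_trans (powR_ge0 _ _) (ul j).
- by apply: is_cvg_seriesZ; apply/cvg_ex; exists l.
Qed.

Lemma series_shift u n h :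
  series (fun j => u (j + h)%N) n = series u (n + h)%N - series u h.
Proof.
rewrite (sub_series_geq _ (leq_addl n h)).
by rewrite -[X in \sum_(X <= _ < _) _](add0n h) big_addn addnK.
Qed.

Lemma C_alpha_shift (alpha : R) (a : nat -> R) (h : nat) :
  C_alpha alpha a -> C_alpha alpha (fun j => a (j + h)%N).
Proof.
move=> [delta [d0 [d2 [l al]]]]; exists delta; split => //; split => //.
exists (l - series (fun j => `|a j| `^ delta) h).
have -> : series (fun j => `|a (j + h)%N| `^ delta) =
    (fun n => series (fun j => `|a j| `^ delta) (n + h)%N - series (fun j => `|a j| `^ delta) h).
  by apply/funext => n; rewrite -series_shift.
apply: cvgB; last exact: cvg_cst.
by apply: cvg_comp al; exact: cvg_addnr.
Qed.

End nonneg_series.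

Section linear_tail.
Context {R : realType} {d : measure_display} {T : measurableType d}.
Variable P : probability T R.
Variables (X : int -> T -> R) (alpha pe : R) (t : int).
Hypothesis iidX : iid P X.
Hypothesis rvX : forall s, regularly_varying_rv P (X s) alpha pe.
Hypothesis EX : 1 < alpha -> forall s, ('E_P[X s] = 0)%E.

Let f := abs_tail P (X 0%R).

Let mX : forall i, measurable_fun setT (X i) := iidX.1.
Let pe01 : 0 <= pe <= 1 := (rvX 0%R).2.1.
Let rvf : regularly_varying_fun f (- alpha) := (rvX 0%R).2.2.1.

Lemma window_tail_small (a : nat -> R) : C_alpha alpha a ->
  forall eta, 0 < eta -> exists N0, forall N, (N0 <= N)%N ->
  exists2 x1 : R, 0 < x1 & forall x, x1 <= x -> forall m,
  pr P [set w | x < `|\sum_(N <= j < m) a j * X (t - j%:Z) w|] <= eta * f x.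
Proof.
move=> [delta [da [d2 [l al]]]] eta eta0; have [d0 dal] := andP da.
have EX0 : 1 < delta -> ('E_P[X 0%R] = 0)%E by move=> d1; apply: EX; exact: lt_trans dal.
pose M := (Num.truncn (4 * alpha / delta)).+1.
have aM : 4 * alpha < M%:R * delta by rewrite -ltr_pdivrMr// truncnS_gt.
have M0 : 0 < M%:R :> R by rewrite ltr0n.
pose C : R := 2 `^ delta * M%:R `^ delta.
have C0 : 0 < C by rewrite mulr_gt0 ?powR_gt0.
(* The three entries give, in this order, the bound [A = 1] of [window_tail_upper], a coefficient of
   [f x] at most [eta / 4], and [M * |a j| <= 1]. *)
pose e := Num.min 1 (Num.min (eta / (4 * C)) (M%:R `^ (- delta))).
have e0 : 0 < e by rewrite !lt_min ltr01 powR_gt0// divr_gt0// mulr_gt0.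
have e1 : e <= 1 by rewrite ge_min lexx.
have e2 : e <= eta / (4 * C) by rewrite !ge_min lexx orbT.
have e3 : e <= M%:R `^ (- delta) by rewrite !ge_min lexx !orbT.
have [N0 hN0] := series_tail_small (fun j => powR_ge0 `|a j| delta) al e0.
have eta4 : 0 < eta / 4 by rewrite divr_gt0.
have [x1 x10 hx1] := @window_tail_upper _ _ _ P X t alpha delta 1 M iidX rvf da d2 EX0 ltr01 aM _ eta4.
exists N0 => N NN0; have [_ sN] := hN0 N NN0.
exists x1 => // x xx1 m.
have aj j : (N <= j < m)%N -> M%:R * `|a j| <= 1.
  move=> /andP[Nj jm]; have h : `|a j| `^ delta <= e.
    apply: le_trans (sN j.+1); rewrite big_nat_recr//= lerDr.
    by apply: sumr_ge0 => i _; exact: powR_ge0.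
  rewrite leNgt; apply/negP => h1.
  have := gt0_ltr_powR d0 (ler01 : 1 \in Num.nneg) (mulr_ge0 (ltW M0) (normr_ge0 (a j)) : _ \in Num.nneg) h1.
  rewrite powR1 powRM ?(ltW M0)// ltNge => /negP; apply.
  have := le_trans h e3; rewrite powRN => h2.
  by rewrite -ler_pdivlMl ?powR_gt0// mulr1.
have sA : \sum_(N <= j < m) `|a j| `^ delta <= 1 by exact: le_trans (sN m) e1.
have mw (b : nat -> R) : measurable_fun setT (fun w => \sum_(N <= j < m) b j * X (t - j%:Z) w).
  exact: (measurable_wrt_measurable (family_sigma_algebra X _)
    (family_sigma_measurable mX) (@measurable_wrt_window_sum _ _ _ X b t N m mX)).
(* Only [|a j|] enters the bound, so changing all signs yields the left tail. *)
have side (b : nat -> R) : (forall j, `|b j| = `|a j|) ->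
    pr P [set w | x < \sum_(N <= j < m) b j * X (t - j%:Z) w] <= eta / 2 * f x.
  move=> ba; apply: le_trans (hx1 x xx1 b N m _ _) _.
  - by move=> j; rewrite ba; exact: aj.
  - by under eq_bigr do rewrite ba.
  under eq_bigr do rewrite ba.
  rewrite ler_wpM2r ?pr_ge0//.
  have h : C * \sum_(N <= j < m) `|a j| `^ delta <= eta / 4.
    apply: le_trans (ler_wpM2l (ltW C0) (le_trans (sN m) e2)) _.
    have -> : C * (eta / (4 * C)) = eta / 4 by field; rewrite gt_eqF.
    by [].
  rewrite /C in h; lra.
have eta2 : eta * f x = eta / 2 * f x + eta / 2 * f x by field.
rewrite eta2; apply: le_trans; last first.
  apply: lerD; [exact: (side a)|apply: (side (fun j => - a j)) => j].
  by rewrite normrN.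
apply: le_trans; last by apply: prU_le; exact: measurable_gt.
apply: pr_le; [exact: measurable_abs_gt|apply: measurableU; exact: measurable_gt|].
move=> w /=; rewrite lter_normr => /orP[|] h; [by left|right].
by under eq_bigr do rewrite mulNr; rewrite sumrN.
Qed.

(** For negative [a] it is the left tail of [X i] that counts; its ratio to [f] tends to [1 - pe],
    because for [x > 0] the two tails add up to [f x]. *)
Lemma right_tail_scaled (a : R) i :
  (fun x => right_tail P (fun w => a * X i w) x / f x) @ +oo -->
  kappa_plus pe a * `|a| `^ alpha.
Proof.
have [_ [_ [_ rp]]] := rvX i.
have fE : abs_tail P (X i) = f by apply/funext => x; exact: identical_abs_tail.
rewrite fE in rp.
have invp (b : R) : 0 < b -> (b^-1) `^ (- alpha) = b `^ alpha.
  by move=> b0; rewrite -powR_inv1 ?(ltW b0)// -powRrM mulN1r opprK.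
rewrite /kappa_plus; have [a_gt|a_lt|a_eq] := ltgtP 0 a.
- rewrite gtr0_norm// -invp//.
  have ai : 0 < a^-1 by rewrite invr_gt0.
  have := tail_scale rvf rp ai; apply: cvg_trans; apply: near_eq_cvg; near=> x.
  congr (fine (P _) / _); apply/seteqP; split => w /=; by rewrite ltr_pdivrMl.
- rewrite ltr0_norm// -invp ?oppr_gt0//.
  have ai : 0 < (- a)^-1 by rewrite invr_gt0 oppr_gt0.
  have rm : (fun x => right_tail P (fun w => - X i w) x / f x) @ +oo --> 1 - pe.
    have : (fun x => 1 - right_tail P (X i) x / f x) @ +oo --> 1 - pe.
      by apply: cvgB => //; exact: cvg_cst.
    apply: cvg_trans; apply: near_eq_cvg; near=> x.
    have fx : 0 < f x by near: x; exact: rvf.1.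
    have x0 : 0 < x by near: x; exact: nbhs_pinfty_gt.
    have fe : f x = right_tail P (X i) x + right_tail P (fun w => - X i w) x.
      rewrite -fE /abs_tail /right_tail -!/(pr P _) -prU.
      - congr (pr P _); apply/seteqP; split => w /=; rewrite lter_normr; first by move/orP.
        by move=> h; apply/orP.
      - exact: measurable_gt.
      - by apply: measurable_gt; exact: measurableT_comp.
      - apply/seteqP; split => // w [] /= h1 h2; have := ltrD h1 h2.
        by rewrite subrr ltNge addr_ge0// ltW.
    have -> : right_tail P (fun w => - X i w) x = f x - right_tail P (X i) x.
      by rewrite fe addrAC subrr add0r.
    by rewrite mulrBl divff ?gt_eqF.
  have := tail_scale rvf rm ai; apply: cvg_trans; apply: near_eq_cvg; near=> x.
  congr (fine (P _) / _); apply/seteqP; split => w /=; by rewrite ltr_pdivrMl ?oppr_gt0// mulrNN.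
- rewrite -a_eq mul0r; apply: (@cvg_trans _ ((fun=> 0) @ +oo)); last exact: cvg_cst.
  apply: near_eq_cvg; near=> x.
  have x0 : 0 < x by near: x; exact: nbhs_pinfty_gt.
  rewrite /right_tail (_ : [set _ | _] = set0) ?measure0 ?mul0r//.
  by apply/seteqP; split => // w /=; rewrite mul0r ltNge ltW.
Unshelve. all: by end_near. Qed.

Lemma right_tail_window (a : nat -> R) n m :
  (fun x => right_tail P (fun w => \sum_(n <= j < m) a j * X (t - j%:Z) w) x / f x) @ +oo -->
  \sum_(n <= j < m) kappa_plus pe (a j) * `|a j| `^ alpha.
Proof.
have base (U : T -> R) : (forall w, U w = 0) ->
    (fun x => right_tail P U x / f x) @ +oo --> (0 : R).
  move=> U0; have := @right_tail_scaled 0 0%R; rewrite /kappa_plus ltxx mul0r.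
  by have -> : (fun w => 0 * X 0%R w) = U by apply/funext => w; rewrite U0 mul0r.
elim: m => [|m IH].
  by rewrite big_geq//; apply: base => w; rewrite big_geq.
have [mn|nm] := ltnP m n.
  by rewrite big_geq//; apply: base => w; rewrite big_geq.
have eS : (fun w => \sum_(n <= j < m.+1) a j * X (t - j%:Z) w) =
    (fun w => \sum_(n <= j < m) a j * X (t - j%:Z) w + a m * X (t - m%:Z) w).
  by apply/funext => w; rewrite big_nat_recr.
rewrite eS big_nat_recr//=.
have mU := @measurable_wrt_window_sum _ _ _ X a t n m mX.
have mV : measurable_wrt (family_sigma X (window t m m.+1)) (fun w => a m * X (t - m%:Z) w).
  apply: measurable_funM; first exact: measurable_cst.
  apply: (@measurable_wrt_family _ _ _ X) => //.
  by apply: window_shift; rewrite leqnn ltnSn.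
apply: (right_tail_add rvf).
- exact: (measurable_wrt_measurable (family_sigma_algebra X _) (family_sigma_measurable mX) mU).
- exact: (measurable_wrt_measurable (family_sigma_algebra X _) (family_sigma_measurable mX) mV).
- by apply: (iid_indep_preimage iidX _ mU mV); exact: window_disjoint.
- exact: IH.
- exact: right_tail_scaled.
Qed.

End linear_tail.

Section linear_process.
Context {R : realType} {d : measure_display} {T : measurableType d}.
Variable P : probability T R.
Variables (X : int -> T -> R) (alpha pe : R) (t : int).
Hypothesis iidX : iid P X.
Hypothesis rvX : forall s, regularly_varying_rv P (X s) alpha pe.
Hypothesis EX : 1 < alpha -> forall s, ('E_P[X s] = 0)%E.

Let f := abs_tail P (X 0%R).

Let mX : forall i, measurable_fun setT (X i) := iidX.1.
Let pe01 : 0 <= pe <= 1 := (rvX 0%R).2.1.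
Let rvf : regularly_varying_fun f (- alpha) := (rvX 0%R).2.2.1.

Lemma measurable_window_sum (b : nat -> R) n m :
  measurable_fun setT (fun w => \sum_(n <= j < m) b j * X (t - j%:Z) w).
Proof.
exact: (measurable_wrt_measurable (family_sigma_algebra X _)
    (family_sigma_measurable mX) (@measurable_wrt_window_sum _ _ _ X b t n m mX)).
Qed.

(** The window bound is independent of [m], and a strict inequality for the limit is inherited by
    all late partial sums. *)
Lemma remainder_small (a : nat -> R) (S : T -> R) : C_alpha alpha a ->
  measurable_fun setT S ->
  {ae P, forall w, series (fun j => a j * X (t - j%:Z) w) @ \oo --> S w} ->
  forall eta, 0 < eta -> exists N0, forall N, (N0 <= N)%N ->
  exists2 x1 : R, 0 < x1 & forall x, x1 <= x ->
  pr P [set w | x < `|S w - \sum_(0 <= j < N) a j * X (t - j%:Z) w|] <= eta * f x.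
Proof.
move=> Ca mS cS eta eta0.
have [N0 hN0] := window_tail_small t iidX rvX EX Ca eta0.
exists N0 => N NN0; have [x1 x10 hx1] := hN0 N NN0; exists x1 => // x xx1.
apply: (@pr_le_ae_eventually _ _ _ P
  (fun m => [set w | x < `|\sum_(N <= j < m) a j * X (t - j%:Z) w|])).
- by move=> m; apply: measurable_abs_gt; exact: measurable_window_sum.
- apply: measurable_abs_gt; apply: measurable_funB => //; exact: measurable_window_sum.
- by move=> m; exact: hx1.
- apply: filterS cS => w cw /= xS.
  set u := fun j => a j * X (t - j%:Z) w in cw *.
  have h : (fun m => `|series u m - series u N|) @ \oo --> `|S w - series u N|.
    by apply: cvg_norm; apply: cvgB => //; exact: cvg_cst.
  have h2 := cvgr_gt _ h _ xS.
  near=> m; have -> : \sum_(N <= j < m) u j = series u m - series u N.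
    by rewrite sub_series_geq//; near: m; exact: nbhs_infty_ge.
  by near: m; exact: h2.
Unshelve. all: by end_near. Qed.

Theorem linear_process_tail (a : nat -> R) (S : T -> R) : C_alpha alpha a ->
  measurable_fun setT S ->
  {ae P, forall w, series (fun j => a j * X (t - j%:Z) w) @ \oo --> S w} ->
  (fun x => right_tail P S x / f x) @ +oo -->
  limn (series (fun j => kappa_plus pe (a j) * `|a j| `^ alpha)).
Proof.
move=> Ca mS cS.
pose u j := kappa_plus pe (a j) * `|a j| `^ alpha; pose e := limn (series u).
rewrite -/u -/e.
have ue : series u @ \oo --> e := kappa_series_cvg pe01 Ca.
have u0 j : 0 <= u j.
  by have /andP[k0 _] := kappa_plus_ge0 (a j) pe01; rewrite mulr_ge0 ?powR_ge0.
pose SN N w := \sum_(0 <= j < N) a j * X (t - j%:Z) w.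
have mSN N : measurable_fun setT (SN N) by exact: measurable_window_sum.
have mD N : measurable_fun setT (fun w => S w - SN N w) by exact: measurable_funB.
have rtN N : (fun x => right_tail P (SN N) x / f x) @ +oo --> series u N.
  exact: (@right_tail_window _ _ _ P X alpha pe t iidX rvX a 0%N N).
have powV (k : R) : 0 < k -> (k^-1) `^ (- alpha) = k `^ alpha.
  by move=> k0; rewrite -powR_inv1 ?(ltW k0)// -powRrM mulN1r opprK.
apply: (@cvg_squeeze_family _ _ _ _ _ (fun k => e * k `^ alpha + (k - 1))
  (fun k => (e - (k - 1)) * k `^ (- alpha) - (k - 1))).
- move=> k k1; have k0 : 0 < k by exact: lt_trans k1.
  pose th := 1 - k^-1; have th0 : 0 < th by rewrite subr_gt0 invf_lt1.
  have km1 : 0 < k - 1 by rewrite subr_gt0.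
  (* Since [f (x * th) / f x] tends to the denominator, the remainder contributes exactly [k - 1] in
     the limit, and this vanishes as [k] decreases to 1. *)
  pose eta := (k - 1) / th `^ (- alpha).
  have eta0 : 0 < eta by rewrite divr_gt0 ?powR_gt0.
  have ki : 0 < k^-1 by rewrite invr_gt0.
  have [N hN] := remainder_small Ca mS cS eta0.
  have [x1 x10 hx1] := hN N (leqnn N).
  exists (fun x => right_tail P (SN N) (k^-1 * x) / f x + eta * (f (x * th) / f x)).
  exists (series u N * (k^-1) `^ (- alpha) + eta * th `^ (- alpha)); split.
  + near=> x.
    have fx : 0 < f x by near: x; exact: rvf.1.
    have xth : x1 <= x * th.
      by rewrite -ler_pdivrMr//; near: x; apply: nbhs_pinfty_ge; exact: num_real.
    rewrite mulrA -mulrDl ler_pM2r ?invr_gt0//.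
    apply: le_trans; last by apply: lerD; [exact: lexx|exact: hx1].
    have m1 := @measurable_gt _ _ _ (SN N) (k^-1 * x) (mSN N).
    have m2 := @measurable_abs_gt _ _ _ (fun w => S w - SN N w) (x * th) (mD N).
    apply: le_trans (prU_le P m1 m2).
    apply: pr_le; [exact: measurable_gt|exact: measurableU|].
    move=> w /= xS; have [h1|h1] := ltP (k^-1 * x) (SN N w); [by left|right].
    apply: lt_le_trans (ler_norm _).
    rewrite -/(SN N w) /th mulrBr mulr1 (mulrC x).
    by apply: ltr_leB.
  + apply: cvgD; first exact: (tail_scale rvf (rtN N) ki).
    by apply: cvgM; [exact: cvg_cst|exact: rvf.2].
  + rewrite powV// /eta divfK ?gt_eqF ?powR_gt0// lerD2r ler_wpM2r ?powR_ge0//.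
    exact: series_partial_le.
- move=> k k1; have k0 : 0 < k by exact: lt_trans k1.
  have km1 : 0 < k - 1 by rewrite subr_gt0.
  pose eta := (k - 1) / (k - 1) `^ (- alpha).
  have eta0 : 0 < eta by rewrite divr_gt0 ?powR_gt0.
  have [N1 hN1] := remainder_small Ca mS cS eta0.
  have [N2 hN2] := series_tail_small u0 ue km1.
  (* [N1] controls the remainder of the process, [N2] brings the partial sum of the coefficients
     within [k - 1] of [e]. *)
  pose N := maxn N1 N2.
  have [x1 x10 hx1] := hN1 N (leq_maxl _ _).
  have [eN _] := hN2 N (leq_maxr _ _).
  exists (fun x => right_tail P (SN N) (k * x) / f x - eta * (f (x * (k - 1)) / f x)).
  exists (series u N * k `^ (- alpha) - eta * (k - 1) `^ (- alpha)); split.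
  + near=> x.
    have fx : 0 < f x by near: x; exact: rvf.1.
    have xth : x1 <= x * (k - 1).
      by rewrite -ler_pdivrMr//; near: x; apply: nbhs_pinfty_ge; exact: num_real.
    rewrite mulrA -mulrBl ler_pM2r ?invr_gt0// lerBlDr.
    apply: le_trans; last by apply: lerD; [exact: lexx|exact: hx1].
    have m1 := @measurable_gt _ _ _ S x mS.
    have m2 := @measurable_abs_gt _ _ _ (fun w => S w - SN N w) (x * (k - 1)) (mD N).
    apply: le_trans (prU_le P m1 m2).
    apply: pr_le; [exact: measurable_gt|exact: measurableU|].
    move=> w /= xS; have [h1|h1] := ltP x (S w); [by left|right].
    rewrite distrC; apply: lt_le_trans (ler_norm _).
    rewrite -/(SN N w) mulrBr mulr1 (mulrC x).
    by apply: ltr_leB.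
  + apply: cvgB; first exact: (tail_scale rvf (rtN N) k0).
    by apply: cvgM; [exact: cvg_cst|exact: rvf.2].
  + rewrite /eta divfK ?gt_eqF ?powR_gt0// lerD2r ler_wpM2r ?powR_ge0//.
    exact: ltW.
- rewrite -[X in _ --> X]addr0 -[X in _ + X](subrr 1).
  apply: cvgD; first exact: powR_cvg_at1.
  by apply: cvgB; [apply: cvg_at_right_filter; exact: cvg_id|exact: cvg_cst].
- have c1 : (fun k : R => k - 1) @ 1^'+ --> (1 - 1 : R).
    by apply: cvgB; [apply: cvg_at_right_filter; exact: cvg_id|exact: cvg_cst].
  have c2 : (fun k : R => k `^ (- alpha)) @ 1^'+ --> (1 : R).
    have := @powR_cvg_at1 R 1 (- alpha).
    by under eq_fun do rewrite mul1r.
  have : (fun k : R => (e - (k - 1)) * k `^ (- alpha) - (k - 1)) @ 1^'+ -->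
      (e - (1 - 1)) * 1 - (1 - 1).
    apply: (cvgB _ c1); apply: (cvgM _ c2); apply: (cvgB _ c1); exact: cvg_cst.
  by rewrite subrr !subr0 mulr1.
Unshelve. all: by end_near. Qed.

End linear_process.

(** * Quantiles and precision *)

Section quantiles.
Context {R : realType} {d : measure_display} {T : measurableType d}.
Variable P : probability T R.
Variable X : T -> R.
Hypothesis mX : measurable_fun setT X.

Lemma cdf_right_tail y : Defs.cdf P X y = 1 - right_tail P X y.
Proof.
have m := @measurable_gt _ _ _ X y mX.
rewrite /Defs.cdf (_ : [set w | X w <= y] = ~` [set w | y < X w]).
  exact: (prC P m).
by apply/seteqP; split => w /=; rewrite leNgt => /negP.
Qed.

Lemma cdf_ge_right_tail p y : (p <= Defs.cdf P X y) = (right_tail P X y <= 1 - p).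
Proof. by rewrite cdf_right_tail lerBrDl addrC -lerBrDl. Qed.

Lemma quantile_set_nonempty p : p < 1 -> [set y | p <= Defs.cdf P X y] !=set0.
Proof.
move=> p1; have : \forall x \near +oo, right_tail P X x < 1 - p.
  by apply: (cvgr_lt _ (right_tail_cvg0 P mX)); rewrite subr_gt0.
by move=> /near_pinftyW[M M0 h]; exists M; rewrite /= cdf_ge_right_tail ltW// h.
Qed.

Lemma quantile_set_lbound p : 0 < p -> has_lbound [set y | p <= Defs.cdf P X y].
Proof.
move=> p0; have mN : measurable_fun setT (fun w => - X w) by exact: measurableT_comp.
have : \forall x \near +oo, right_tail P (fun w => - X w) x < p.
  by apply: (cvgr_lt _ (right_tail_cvg0 P mN)).
move=> /near_pinftyW[M M0 h]; exists (- M - 1) => y /=; rewrite leNgt => hy.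
rewrite leNgt; apply/negP => yM; move: hy => /negP; apply.
apply: le_lt_trans (h M (lexx _)); apply: pr_le.
- rewrite (_ : [set _ | _] = ~` [set w | y < X w]); first exact/measurableC/measurable_gt.
  by apply/seteqP; split => w /=; rewrite leNgt => /negP.
- exact: measurable_gt.
- by move=> w /= Xy; rewrite ltrNr; apply: le_lt_trans Xy (lt_trans yM _); rewrite ltrBlDr ltrDl.
Qed.

(** Right continuity of the tail: every level [q + 1/(n+1)] lies above a point of the set whose
    infimum is [q], and [X > q] is the union of the corresponding events. *)
Lemma right_tail_quantile p : 0 < p < 1 -> right_tail P X (quantile P X p) <= 1 - p.
Proof.
move=> /andP[p0 p1]; set q := quantile P X p.
apply: (@pr_le_ae_eventually _ _ _ P (fun n => [set w | q + n.+1%:R^-1 < X w])).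
- by move=> n; exact: measurable_gt.
- exact: measurable_gt.
- move=> n; have h : inf [set y | p <= Defs.cdf P X y] < q + n.+1%:R^-1.
    by rewrite ltrDl invr_gt0.
  have [y py yq] := inf_lt (quantile_set_nonempty p1) h.
  apply: le_trans (right_tail_noninc P mX (ltW yq)) _.
  by rewrite -cdf_ge_right_tail.
- apply: aeW => w /= qX; near=> n.
  have : n.+1%:R^-1 < X w - q.
    near: n; have s0 : 0 < X w - q by rewrite subr_gt0.
    exact: (near_infty_natSinv_lt (PosNum s0)).
  by rewrite ltrBrDl.
Unshelve. all: by end_near. Qed.

Lemma lt_quantile p y : 0 < p -> y < quantile P X p -> 1 - p < right_tail P X y.
Proof.
move=> p0 yq; rewrite ltNge -cdf_ge_right_tail; apply/negP => h.
move: yq; rewrite ltNge => /negP; apply; apply: ge_inf => //.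
exact: quantile_set_lbound.
Qed.

Lemma quantile_cvg_pinfty : (forall x, 0 < right_tail P X x) -> quantile P X @ 1^'- --> +oo.
Proof.
move=> G0; apply/cvgryPge => A; near=> p.
have p1 : p < 1 by near: p; exact: nbhs_left_lt.
apply: lb_le_inf; first exact: quantile_set_nonempty.
move=> y /=; rewrite cdf_ge_right_tail => hy; rewrite leNgt; apply/negP => yA.
have : right_tail P X A <= 1 - p by apply: le_trans hy; exact/right_tail_noninc/ltW.
rewrite leNgt => /negP; apply; rewrite ltrBlDr -ltrBlDl.
near: p; apply: nbhs_left_gt; by rewrite gtrBl.
Unshelve. all: by end_near. Qed.

(** The tail may jump at the quantile [q], but at [q / k] it already exceeds [1 - p], and regular
    variation compares the tails at [q / k] and [q] up to the factor k to the power [alpha]. *)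
Lemma right_tail_quantile_cvg (alpha c : R) (f : R -> R) :
  regularly_varying_fun f (- alpha) -> (fun x => right_tail P X x / f x) @ +oo --> c ->
  0 < c -> (forall x, 0 < right_tail P X x) ->
  (fun p => right_tail P X (quantile P X p) / (1 - p)) @ 1^'- --> (1 : R).
Proof.
move=> rv Gc c0 G0; have qoo := quantile_cvg_pinfty G0.
apply: (@cvg_squeeze_family _ _ _ _ _ (fun k => (1 : R)) (fun k => 1 * k `^ (- alpha))).
- move=> k k1; exists (fun=> 1 : R), 1; split => //; last exact: cvg_cst.
  near=> p.
  have p1 : p < 1 by near: p; exact: nbhs_left_lt.
  have p0 : 0 < p by near: p; exact: nbhs_left_gt.
  by rewrite ler_pdivrMr ?subr_gt0// mul1r right_tail_quantile// p0.
- move=> k k1; have k0 : 0 < k by exact: lt_trans k1.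
  have ki : 0 < k^-1 by rewrite invr_gt0.
  pose r x := (right_tail P X x / f x) / (right_tail P X (k^-1 * x) / f x).
  have rc : r @ +oo --> c / (c * (k^-1) `^ (- alpha)).
    apply: cvgM => //; apply: cvgV; last exact: tail_scale.
    by rewrite mulf_neq0 ?gt_eqF ?powR_gt0.
  exists (r \o quantile P X), (c / (c * (k^-1) `^ (- alpha))); split.
  + have q0 : \forall p \near (1:R)^'-, 0 < quantile P X p.
      by move/cvgryPgt : qoo; apply.
    have fq : \forall p \near (1:R)^'-, 0 < f (quantile P X p).
      exact: (qoo _ rv.1).
    near=> p.
    have p1 : p < 1 by near: p; exact: nbhs_left_lt.
    have p0 : 0 < p by near: p; exact: nbhs_left_gt.
    have qp : 0 < quantile P X p by near: p; exact: q0.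
    have fp : 0 < f (quantile P X p) by near: p; exact: fq.
    rewrite /r /= invf_div mulrA divfK ?gt_eqF//.
    rewrite ler_wpM2l ?right_tail_ge0// lef_pV2 ?posrE ?subr_gt0// ltW//.
    by apply: lt_quantile => //; rewrite gtr_pMl// invf_lt1.
  + exact: cvg_comp qoo rc.
  + have e : (k^-1) `^ (- alpha) = k `^ alpha.
      by rewrite -(powR_inv1 (ltW k0)) -powRrM mulN1r opprK.
    by rewrite e mul1r powRN invfM mulrA divff ?mul1r// gt_eqF.
- exact: cvg_cst.
- exact: powR_cvg_at1.
Unshelve. all: by end_near. Qed.

End quantiles.

(** * Precision when the target is a predictor plus independent noise *)

Section prediction.
Context {R : realType} {d : measure_display} {T : measurableType d}.
Variable P : probability T R.
Variables (V U Z : T -> R) (f : R -> R) (alpha cU cV : R) (past : set (set T)).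
Hypothesis mV : measurable_fun setT V.
Hypothesis mU : measurable_fun setT U.
Hypothesis mZ : measurable_fun setT Z.
Hypothesis VE : {ae P, forall w, V w = Z w + U w}.
Hypothesis rvf : regularly_varying_fun f (- alpha).
Hypothesis Uc : (fun x => right_tail P U x / f x) @ +oo --> cU.
Hypothesis Vc : (fun x => right_tail P V x / f x) @ +oo --> cV.
Hypothesis alpha0 : 0 < alpha.
Hypothesis cU0 : 0 < cU.
Hypothesis cUV : cU <= cV.
Hypothesis pastm : past `<=` measurable.
Hypothesis past_indep : forall A (B : set R), past A -> measurable B ->
  P (A `&` Z @^-1` B) = (P A * P (Z @^-1` B))%E.
Hypothesis pastU : forall B : set R, measurable B -> past (U @^-1` B).

Let cV0 : 0 < cV := lt_le_trans cU0 cUV.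
Let q := quantile P V.

Lemma pr_le_ae (A B : set T) : measurable A -> measurable B ->
  {ae P, forall w, A w -> B w} -> pr P A <= pr P B.
Proof.
move=> mA mB AB; apply: (@pr_le_ae_eventually _ _ _ P (fun=> B)) => //.
by apply: filterS AB => w AB Aw; apply: nearW => _; exact: AB.
Qed.

Lemma right_tail_pos (W : T -> R) (c : R) : measurable_fun setT W -> 0 < c ->
  (fun x => right_tail P W x / f x) @ +oo --> c -> forall x, 0 < right_tail P W x.
Proof.
move=> mW c0 Wc x.
have : \forall y \near +oo, 0 < right_tail P W y.
  have h := cvgr_gt _ Wc _ c0.
  near=> y; have fy : 0 < f y by near: y; exact: rvf.1.
  have : 0 < right_tail P W y / f y by near: y; exact: h.
  by rewrite pmulr_lgt0// invr_gt0.
move=> /near_pinftyW[M M0 hM].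
apply: (lt_le_trans (hM (Num.max M x) _)); first by rewrite le_max lexx.
by apply: right_tail_noninc => //; rewrite le_max lexx orbT.
Unshelve. all: by end_near. Qed.

Let gtE (W : T -> R) y : [set w | y < W w] = W @^-1` `]y, +oo[.
Proof. by apply/seteqP; split => w /=; rewrite in_itv/= andbT. Qed.

Let absE (W : T -> R) y : ~` [set w | y < `|W w|] = W @^-1` `[- y, y].
Proof.
apply/seteqP; split => w /=; rewrite in_itv/= -ler_norml.
  by move/negP; rewrite -leNgt.
by move=> h; apply/negP; rewrite -leNgt.
Qed.

Let pastgt y : past [set w | y < U w].
Proof. by rewrite gtE; apply: pastU; exact: measurable_itv. Qed.

Let prep (W : T -> R) (B : set R) : measurable_fun setT W -> measurable B -> measurable (W @^-1` B).
Proof. by move=> mW mB; rewrite -[X in measurable X]setTI; exact: mW. Qed.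

Let pr_past A (B : set R) : past A -> measurable B ->
  pr P (A `&` Z @^-1` B) = pr P A * pr P (Z @^-1` B).
Proof.
by move=> pA mB; apply: prI_indep; [exact: pastm|exact: prep|exact: past_indep].
Qed.

(** [A] is arbitrary in the past, so the bound covers every competing predictor as well as the
    exceedance event of [U]. *)
Lemma precision_upper A k y : past A ->
  pr P ([set w | y < V w] `&` A) <=
  right_tail P U (k * y) + pr P A * right_tail P Z ((1 - k) * y).
Proof.
move=> pA; have mA := pastm pA.
have -> : right_tail P Z ((1 - k) * y) = pr P (Z @^-1` `](1 - k) * y, +oo[) by rewrite -gtE.
rewrite -pr_past//.
have m1 := @measurable_gt _ _ _ U (k * y) mU.
have m2 : measurable (A `&` Z @^-1` `](1 - k) * y, +oo[).
  by apply: measurableI => //; exact: prep.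
apply: le_trans (prU_le P m1 m2); apply: pr_le_ae.
- by apply: measurableI => //; exact: measurable_gt.
- exact: measurableU.
- apply: filterS VE => w e [/= Vy Aw].
  have [h|h] := ltP (k * y) (U w); [by left|right]; split => //=.
  by rewrite in_itv/= andbT mulrBl mul1r ltrBlDr (lt_le_trans Vy)// e lerD2l.
Qed.

Lemma precision_lower A t y : measurable A ->
  {ae P, forall w, t * y < U w -> A w} ->
  right_tail P U (t * y) * (1 - abs_tail P Z ((t - 1) * y)) <=
  pr P ([set w | y < V w] `&` A).
Proof.
move=> mA UA.
have mabs := @measurable_abs_gt _ _ _ Z ((t - 1) * y) mZ.
rewrite /abs_tail -/(pr P _) -prC// absE -pr_past//.
apply: pr_le_ae.
- by apply: measurableI; [exact: measurable_gt|exact: prep].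
- by apply: measurableI => //; exact: measurable_gt.
- apply: filterS2 VE UA => w e UA [/= h1]; rewrite in_itv/= => /andP[h2 _].
  split => /=; last exact: UA.
  rewrite e; move: h2; rewrite mulrBl mul1r opprB => h2.
  by rewrite -(subrK (t * y) y) addrC [ltRHS]addrC; exact: ltr_leD.
Qed.

Let GV0 : forall x, 0 < right_tail P V x := right_tail_pos mV cV0 Vc.
Let GU0 : forall x, 0 < right_tail P U x := right_tail_pos mU cU0 Uc.
Let qoo : q @ 1^'- --> +oo := quantile_cvg_pinfty mV GV0.

(** At the level [q p] the right tail of [V] may stand for [1 - p], their ratio tending to 1. *)
Lemma tail_ratio_quantile k : 0 < k ->
  (fun p => right_tail P U (k * q p) / (1 - p)) @ 1^'- --> cU / cV * k `^ (- alpha).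
Proof.
move=> k0.
have h1 : (fun x => (right_tail P U (k * x) / f x) / (right_tail P V x / f x)) @ +oo -->
    (cU * k `^ (- alpha)) / cV.
  by apply: cvgM; [exact: tail_scale|apply: cvgV => //; rewrite gt_eqF].
have h2 := right_tail_quantile_cvg mV rvf Vc cV0 GV0.
have h3 : (fun p => (right_tail P U (k * q p) / f (q p)) / (right_tail P V (q p) / f (q p)) *
    (right_tail P V (q p) / (1 - p))) @ 1^'- --> cU * k `^ (- alpha) / cV * 1.
  by apply: cvgM h2; exact: (cvg_comp _ _ qoo h1).
have -> : cU / cV * k `^ (- alpha) = cU * k `^ (- alpha) / cV * 1 by rewrite mulr1 mulrAC.
apply: cvg_trans h3; apply: near_eq_cvg; near=> p.
have fq : 0 < f (q p) by near: p; exact: (qoo rvf.1).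
have p1 : p < 1 by near: p; exact: nbhs_left_lt.
by field; rewrite !gt_eqF ?subr_gt0 ?GV0.
Unshelve. all: by end_near. Qed.

(** The strict inequality is the room both theorems use: for [p] near 1 the event [U > t q] has
    probability below [1 - p]. *)
Let rho_lt1 t : 1 < t -> cU / cV * t `^ (- alpha) < 1.
Proof.
move=> t1; have h : t `^ (- alpha) < 1.
  have := @powR_lt_exp R t (- alpha) 0 t1; rewrite powRr0; apply.
  by rewrite oppr_lt0.
have h2 : cU / cV <= 1 by rewrite ler_pdivrMr// mul1r.
apply: le_lt_trans h; rewrite ler_piMl ?powR_ge0//.
Qed.

Let shrink_cvg0 k : 0 < k -> (fun p => right_tail P Z (k * q p)) @ 1^'- --> (0 : R).
Proof.
by move=> k0; exact: (cvg_comp _ _ qoo (cvg_pinfty_scale k0 (right_tail_cvg0 P mZ))).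
Qed.

Let abs_cvg1 k : 0 < k -> (fun p => 1 - abs_tail P Z (k * q p)) @ 1^'- --> (1 : R).
Proof.
move=> k0; rewrite -[X in _ --> X]subr0; apply: cvgB; first exact: cvg_cst.
exact: (cvg_comp _ _ qoo (cvg_pinfty_scale k0 (abs_tail_cvg0 P mZ))).
Qed.

Let powV (k : R) : 0 < k -> (k^-1) `^ (- alpha) = k `^ alpha.
Proof. by move=> k0; rewrite -(powR_inv1 (ltW k0)) -powRrM mulN1r opprK. Qed.

Theorem tail_dep_of_predictor : tail_dep_coeff_is P V U (cU / cV).
Proof.
rewrite /tail_dep_coeff_is.
pose qU := quantile P U; pose aU p := right_tail P U (qU p).
have haU : (fun p => aU p / (1 - p)) @ 1^'- --> (1 : R).
  exact: (right_tail_quantile_cvg mU rvf Uc cU0 GU0).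
have hV : (fun p => (aU p / (1 - p))^-1) @ 1^'- --> (1 : R).
  by rewrite -[X in _ --> X]invr1; apply: cvgV.
have cE p : condprob P (exceed P V p) (exceed P U p) =
    pr P ([set w | q p < V w] `&` [set w | qU p < U w]) / aU p by [].
apply: (@cvg_squeeze_family _ _ _ _ _ (fun t => cU / cV * t `^ alpha)
  (fun t => cU / cV * t `^ (- alpha))).
- move=> t t1; have t0 : 0 < t by exact: lt_trans t1.
  have ti : 0 < t^-1 by rewrite invr_gt0.
  have th0 : 0 < 1 - t^-1 by rewrite subr_gt0 invf_lt1.
  exists (fun p => right_tail P U (t^-1 * q p) / (1 - p) * (aU p / (1 - p))^-1 +
    right_tail P Z ((1 - t^-1) * q p)).
  exists (cU / cV * (t^-1) `^ (- alpha) * 1 + 0); split.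
  + near=> p; have p1 : p < 1 by near: p; exact: nbhs_left_lt.
    rewrite cE ler_pdivrMr ?GU0//.
    apply: le_trans (precision_upper (t^-1) (q p) (pastgt (qU p))) _.
    have -> : pr P [set w | qU p < U w] = aU p by [].
    rewrite [leRHS]mulrDl lerD//; last by rewrite mulrC.
    rewrite le_eqVlt; apply/orP; left; apply/eqP.
    by field; rewrite !gt_eqF ?GU0 ?subr_gt0.
  + apply: cvgD; last exact: shrink_cvg0.
    by apply: cvgM hV; exact: tail_ratio_quantile.
  + by rewrite addr0 mulr1 powV.
- move=> t t1; have t0 : 0 < t by exact: lt_trans t1.
  have tm : 0 < t - 1 by rewrite subr_gt0.
  exists (fun p => right_tail P U (t * q p) / (1 - p) * (aU p / (1 - p))^-1 *
    (1 - abs_tail P Z ((t - 1) * q p))).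
  exists (cU / cV * t `^ (- alpha) * 1 * 1); split.
  + have r1 := rho_lt1 t1; set r := cU / cV * t `^ (- alpha) in r1.
    (* The midpoint of [r] and 1 separates the tail of [U] at [t * q p] from its tail at [qU p]; the
       levels are then ordered the other way round. *)
    have m1 : r < (r + 1) / 2 by rewrite midf_lt.
    have m2 : (r + 1) / 2 < 1 by rewrite midf_lt.
    have n1 := cvgr_lt _ (tail_ratio_quantile t0) _ m1.
    have n2 := cvgr_gt _ haU _ m2.
    near=> p; have p1 : p < 1 by near: p; exact: nbhs_left_lt.
    have k1 : right_tail P U (t * q p) / (1 - p) < (r + 1) / 2 by near: p; exact: n1.
    have k2 : (r + 1) / 2 < aU p / (1 - p) by near: p; exact: n2.
    have tq : qU p < t * q p.
      rewrite ltNge; apply/negP => /(right_tail_noninc P mU); rewrite leNgt => /negP; apply.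
      by have := lt_trans k1 k2; rewrite ltr_pM2r// invr_gt0 subr_gt0.
    rewrite cE ler_pdivlMr ?GU0//.
    have UA : {ae P, forall w, t * q p < U w -> [set w | qU p < U w] w}.
      by apply: aeW => w /= h; exact: lt_trans h.
    apply: le_trans (precision_lower (measurable_gt _ mU) UA).
    rewrite le_eqVlt; apply/orP; left; apply/eqP.
    by field; rewrite !gt_eqF ?GU0 ?subr_gt0.
  + apply: cvgM; last exact: abs_cvg1.
    by apply: cvgM hV; exact: tail_ratio_quantile.
  + by rewrite !mulr1.
- exact: powR_cvg_at1.
- exact: powR_cvg_at1.
Unshelve. all: by end_near. Qed.

Lemma condprob_le1 A B : measurable A -> measurable B -> condprob P A B <= 1.
Proof.
move=> mA mB; rewrite /condprob -/(pr P _) -/(pr P B).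
have [->|B0] := eqVneq (pr P B) 0; first by rewrite invr0 mulr0.
have B0' : 0 < pr P B by rewrite lt_neqAle eq_sym B0 pr_ge0.
by rewrite ler_pdivrMr// mul1r pr_le//; exact: measurableI.
Qed.

(** The indicator is 0 with probability exactly [p], so 0 is its [p]-quantile. Thus every past event
    of probability [1 - p] is the exceedance event of a calibrated predictor. *)
Lemma exceed_indicator (A : set T) p : 0 < p < 1 -> measurable A -> pr P A = 1 - p ->
  exceed P (\1_A) p = A.
Proof.
move=> /andP[p0 p1] mA pA.
have mI : measurable_fun setT (\1_A : T -> R) by exact: measurable_indic.
have q0 : quantile P \1_A p = 0.
  apply/eqP; rewrite eq_le; apply/andP; split.
    apply: ge_inf; first exact: quantile_set_lbound.
    rewrite /= cdf_ge_right_tail// -pA /right_tail -/(pr P _).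
    apply: pr_le => //; first exact: measurable_gt.
    move=> w /=; rewrite indicE; case: (boolP (w \in A)) => [/set_mem//|_].
    by rewrite ltxx.
  apply: lb_le_inf; first exact: quantile_set_nonempty.
  move=> y /=; rewrite leNgt => h; rewrite leNgt; apply/negP => y0; move: h => /negP; apply.
  rewrite /Defs.cdf (_ : [set _ | _] = set0) ?measure0//.
  apply/seteqP; split => // w /=; rewrite leNgt => /negP; apply.
  by apply: lt_le_trans y0 _; rewrite indicE.
rewrite /exceed q0; apply/seteqP; split => w /=; rewrite indicE.
  by case: (boolP (w \in A)) => [/set_mem//|_]; rewrite ltxx.
by move=> Aw; rewrite mem_set.
Qed.

Variables (Y : int -> T -> R) (s : int).
Hypothesis pastY : past_sigma Y s `<=` past.
(** Predictors live in the uncompleted past of [Y], to which [U > y] belongs only up to a null set;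
    hence the almost sure inclusion. *)
Hypothesis exact_event : forall y v, right_tail P U y <= v -> v <= 1 ->
  exists A, [/\ past_sigma Y s A, pr P A = v & {ae P, forall w, y < U w -> A w}].

Lemma predictor_indicator A : past_sigma Y s A -> predictor Y s (\1_A : T -> R).
Proof.
move=> FA B mB.
have [s0 sC sU] := @smallest_sigma_algebra _ (setT : set T)
  [set C | exists s' (A : set R), s' <= s /\ measurable A /\ C = Y s' @^-1` A].
have -> : (\1_A : T -> R) @^-1` B =
    if (1 : R) \in B then (if (0 : R) \in B then setT `\` set0 else A)
    else (if (0 : R) \in B then setT `\` A else set0).
  rewrite preimage_indic; case: ifPn => _; case: ifPn => _ //; first by rewrite setD0.
  by rewrite setTD.
case: ifPn => _; case: ifPn => _ //; exact: sC.
Qed.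

Theorem optimal_precision_of_predictor :
  extremal_optimal_precision_is P Y s V (cU / cV).
Proof.
rewrite /extremal_optimal_precision_is.
pose Cs p := [set c | exists W, predictor Y s W /\ fine (P (exceed P W p)) = 1 - p /\
   c = condprob P (exceed P V p) (exceed P W p)].
have exW W p : predictor Y s W -> past (exceed P W p).
  move=> pW; apply: pastY; rewrite /exceed gtE; apply: pW; exact: measurable_itv.
have ubC p : has_ubound (Cs p).
  exists 1 => _ [W [pW [_ ->]]]; apply: condprob_le1; first exact: measurable_gt.
  exact/pastm/exW.
have wit p t : 0 < p < 1 -> right_tail P U (t * q p) <= 1 - p ->
    exists2 c, Cs p c &
    right_tail P U (t * q p) * (1 - abs_tail P Z ((t - 1) * q p)) / (1 - p) <= c.
  move=> p01 Up; have [p0 p1] := andP p01.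
  have v1 : 1 - p <= 1 by rewrite gerBl ltW.
  have [A [FA pA UA]] := exact_event Up v1.
  have mA : measurable A by exact/pastm/pastY.
  have eA := exceed_indicator p01 mA pA.
  exists (condprob P (exceed P V p) (exceed P \1_A p)).
    by exists (\1_A); split; [exact: predictor_indicator|split => //; rewrite eA].
  rewrite eA /condprob -!/(pr P _) pA ler_pM2r ?invr_gt0 ?subr_gt0//.
  exact: precision_lower.
have small t : 1 < t -> \forall p \near (1:R)^'-, right_tail P U (t * q p) <= 1 - p.
  move=> t1; have t0 : 0 < t by exact: lt_trans t1.
  have n1 := cvgr_lt _ (tail_ratio_quantile t0) _ (rho_lt1 t1).
  near=> p; have p1 : p < 1 by near: p; exact: nbhs_left_lt.
  rewrite -[leRHS]mul1r -ler_pdivrMr ?subr_gt0// ltW//.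
  by near: p; exact: n1.
apply: (@cvg_squeeze_family _ _ _ _ _ (fun t => cU / cV * t `^ alpha)
  (fun t => cU / cV * t `^ (- alpha))).
- move=> t t1; have t0 : 0 < t by exact: lt_trans t1.
  have ti : 0 < t^-1 by rewrite invr_gt0.
  have th0 : 0 < 1 - t^-1 by rewrite subr_gt0 invf_lt1.
  have st := small _ t1.
  exists (fun p => right_tail P U (t^-1 * q p) / (1 - p) +
    right_tail P Z ((1 - t^-1) * q p)).
  exists (cU / cV * (t^-1) `^ (- alpha) + 0); split.
  + near=> p; have p1 : p < 1 by near: p; exact: nbhs_left_lt.
    have p0 : 0 < p by near: p; exact: nbhs_left_gt.
    have Up : right_tail P U (t * q p) <= 1 - p by near: p; exact: st.
    (* Bounding a [sup] needs a nonempty set; the witness for the lower bound supplies the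
       member. *)
    apply: ge_sup; first by have [|c Cc _] := wit p t _ Up; [rewrite p0|exists c].
    move=> _ [W [pW [eW ->]]].
    rewrite /condprob eW ler_pdivrMr ?subr_gt0//.
    apply: le_trans (precision_upper (t^-1) (q p) (exW W p pW)) _.
    by rewrite {1}/pr eW [leRHS]mulrDl divfK ?gt_eqF ?subr_gt0// lerD2l mulrC.
  + by apply: cvgD; [exact: tail_ratio_quantile|exact: shrink_cvg0].
  + by rewrite addr0 powV.
- move=> t t1; have t0 : 0 < t by exact: lt_trans t1.
  have tm : 0 < t - 1 by rewrite subr_gt0.
  have st := small _ t1.
  exists (fun p => right_tail P U (t * q p) / (1 - p) *
    (1 - abs_tail P Z ((t - 1) * q p))).
  exists (cU / cV * t `^ (- alpha) * 1); split.
  + near=> p; have p1 : p < 1 by near: p; exact: nbhs_left_lt.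
    have p0 : 0 < p by near: p; exact: nbhs_left_gt.
    have Up : right_tail P U (t * q p) <= 1 - p by near: p; exact: st.
    have p01 : 0 < p < 1 by rewrite p0.
    have [c Cc hc] := wit p t p01 Up.
    apply: le_trans (ub_le_sup (ubC p) Cc); by rewrite mulrAC.
  + by apply: cvgM; [exact: tail_ratio_quantile|exact: abs_cvg1].
  + by rewrite mulr1.
- exact: powR_cvg_at1.
- exact: powR_cvg_at1.
Unshelve. all: by end_near. Qed.

End prediction.

(** * Events of prescribed probability *)

Section exact_events.
Context {R : realType} {d : measure_display} {T : measurableType d}.
Variable P : probability T R.

(** Greedy filling: the members of [L] are added to [B] one by one until the next
    one would push the probability above [v]. *)
Lemma fill_step (H : set (set T)) (B : set T) (L : seq (set T)) (v e : R) :
  H `<=` measurable -> (forall A C, H A -> H C -> H (A `|` C)) -> H B ->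
  (forall C, C \in L -> H C /\ pr P C <= e) -> \big[setU/set0]_(C <- L) C = setT ->
  pr P B <= v -> v <= 1 -> 0 <= e ->
  exists A, [/\ H A, B `<=` A, v - e <= pr P A & pr P A <= v].
Proof.
move=> Hm HU HB HL cov Bv v1 e0.
suff : (exists A, [/\ H A, B `<=` A, v - e <= pr P A & pr P A <= v]) \/
    (H (B `|` \big[setU/set0]_(C <- L) C) /\ pr P (B `|` \big[setU/set0]_(C <- L) C) <= v).
  case=> // -[HA pA]; eexists; split; [exact: HA|exact: subsetUl| |exact: pA].
  rewrite cov setUT /pr probability_setT/=; lra.
elim: L HL {cov} => [|C L IH] HL.
  by right; rewrite big_nil setU0.
have [HC pC] : H C /\ pr P C <= e by apply: HL; rewrite mem_head.
have [|h|[HA pA]] := IH; [|by left|].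
  by move=> D DL; apply: HL; rewrite inE DL orbT.
rewrite big_cons setUCA; have HCA := HU _ _ HC HA.
have [h|h] := leP (pr P (C `|` (B `|` \big[setU/set0]_(j <- L) j))) v; first by right.
left; eexists; split; [exact: HA|exact: subsetUl| |exact: pA].
have := prU_le P (Hm _ HC) (Hm _ HA); lra.
Qed.

(** Filling is repeated with finer and finer partitions: after step [n] at most [1/(n+1)] is
    missing, so the increasing union, which still contains [B], has probability [v]. *)
Lemma exists_event_pr (H : set (set T)) (B : set T) (v : R) :
  H `<=` measurable -> (forall A C, H A -> H C -> H (A `|` C)) ->
  (forall A : nat -> set T, (forall n, H (A n)) -> H (\bigcup_n A n)) ->
  (forall e, 0 < e -> exists L : seq (set T),
     (forall C, C \in L -> H C /\ pr P C <= e) /\ \big[setU/set0]_(C <- L) C = setT) ->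
  H B -> pr P B <= v -> v <= 1 ->
  exists A, [/\ H A, B `<=` A & pr P A = v].
Proof.
move=> Hm HU HUU HL HB Bv v1.
(* The subtype carries membership in [H] and the bound [v] through the recursion. *)
pose S := {A : set T | H A /\ pr P A <= v}.
have step (n : nat) (A : S) : {A' : S | sval A `<=` sval A' /\ v - n.+1%:R^-1 <= pr P (sval A')}.
  apply: cid; case: A => A [HA pA] /=.
  have e0 : 0 < n.+1%:R^-1 :> R by rewrite invr_gt0.
  have [L [hL cov]] := HL _ e0.
  have [A' [HA' AA' lo hi]] := fill_step Hm HU HA hL cov pA v1 (ltW e0).
  by exists (exist _ A' (conj HA' hi)).
pose A0 : S := exist _ B (conj HB Bv).
pose seqA := fix F n : S := if n is m.+1 then sval (step m (F m)) else A0.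
have mono n : sval (seqA n) `<=` sval (seqA n.+1).
  by have [] := svalP (step n (seqA n)).
have lo n : v - n.+1%:R^-1 <= pr P (sval (seqA n.+1)).
  by have [] := svalP (step n (seqA n)).
have HA n : H (sval (seqA n)) by have [] := svalP (seqA n).
have hi n : pr P (sval (seqA n)) <= v by have [] := svalP (seqA n).
have monoT m n : (m <= n)%N -> sval (seqA m) `<=` sval (seqA n).
  elim: n => [|n IH]; first by rewrite leqn0 => /eqP ->.
  rewrite leq_eqVlt => /predU1P[-> //|]; rewrite ltnS => /IH h.
  exact: subset_trans h (mono n).
have HUA : H (\bigcup_n sval (seqA n)) by exact: HUU.
exists (\bigcup_n sval (seqA n)); split => //.
  by move=> w Bw; exists 0%N.
apply/eqP; rewrite eq_le; apply/andP; split.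
  apply: (@pr_le_ae_eventually _ _ _ P (fun n => sval (seqA n))) => //.
  - by move=> n; exact: Hm.
  - exact: Hm.
  - by apply: aeW => w [m _ h]; exists m => // n /= mn; exact: (monoT _ _ mn).
rewrite leNgt; apply/negP => h.
have h0 : 0 < v - pr P (\bigcup_n sval (seqA n)) by rewrite subr_gt0.
have [n _ hn] := near_infty_natSinv_lt (PosNum h0).
have := hn n (leqnn n); rewrite /= ltrBrDl -ltrBrDr => h1.
have := lt_le_trans h1 (lo n); rewrite ltNge => /negP; apply.
by apply: pr_le; [exact: Hm|exact: Hm|move=> w Aw; exists n.+1].
Qed.

(** Atoms of a single variable do no harm: each new variable splits every cell by an event
    independent of it, of probability strictly between 0 and 1, so the largest cell shrinks by the
    factor [r < 1]. *)
Lemma iid_partition (X : int -> T -> R) (alpha pe : R) (t : int) :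
  iid P X -> (forall s, regularly_varying_rv P (X s) alpha pe) ->
  forall e, 0 < e -> exists n (L : seq (set T)),
    (forall C, C \in L -> family_sigma X (window t 0 n) C /\ pr P C <= e) /\
    \big[setU/set0]_(C <- L) C = setT.
Proof.
move=> iidX rvX e e0; have mX := iidX.1.
pose f := abs_tail P (X 0%R).
(* Regular variation makes [f] eventually positive, and [f] tends to 0, so the law of [|X 0|] is not
   degenerate at such an [x]. *)
have [x [fx0 fx1]] : exists x, 0 < f x /\ f x < 1.
  have h1 := (rvX 0%R).2.2.1.1.
  have h2 := cvgr_lt _ (abs_tail_cvg0 P (mX 0%R)) _ (ltr01).
  have : \forall x \near +oo, 0 < f x /\ f x < 1.
    by near=> x; split; near: x; [exact: h1|exact: h2].
  by move=> /near_pinftyW[M M0 h]; exists M; exact: h.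
pose r := Num.max (f x) (1 - f x).
have r0 : 0 <= r by rewrite le_max ltW.
have r1 : r < 1 by rewrite gt_max fx1 gtrBl.
pose D j := [set w | x < `|X (t - j%:Z) w|].
have mD j : measurable (D j) by exact: measurable_abs_gt.
have pD j : pr P (D j) = f x by exact: (identical_abs_tail iidX (t - j%:Z) x).
have sD j : family_sigma X (window t j j.+1) (D j).
  apply: sub_sigma_algebra; exists (t - j%:Z), [set y | x < `|y|]; split.
    by apply: window_shift; rewrite leqnn ltnSn.
  split => //.
  by have := @measurable_abs_gt _ _ _ (fun y : R => y) x; apply; exact: measurable_id.
have key n : exists L : seq (set T),
    (forall C, C \in L -> family_sigma X (window t 0 n) C /\ pr P C <= r ^+ n) /\
    \big[setU/set0]_(C <- L) C = setT.
  elim: n => [|n [L [hL cov]]].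
    exists [:: setT]; split; last by rewrite big_seq1.
    move=> C; rewrite inE => /eqP ->; split.
      by have [s0 sC _] := family_sigma_algebra X (window t 0 0);
        rewrite -(setD0 setT); exact: sC.
    by rewrite expr0 pr_le1.
  exists ([seq C `&` D n | C <- L] ++ [seq C `&` ~` D n | C <- L]); split.
    have sub1 : family_sigma X (window t 0 n) `<=` family_sigma X (window t 0 n.+1).
      by apply: family_sigma_sub; exact: windowS.
    have sub2 : family_sigma X (window t n n.+1) `<=` family_sigma X (window t 0 n.+1).
      by apply: family_sigma_sub; exact: windowS.
    have [s0 sC sU] := family_sigma_algebra X (window t 0 n.+1).
    have [_ sCn _] := family_sigma_algebra X (window t n n.+1).
    have sI A B : family_sigma X (window t 0 n.+1) A -> family_sigma X (window t 0 n.+1) B ->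
        family_sigma X (window t 0 n.+1) (A `&` B).
      move=> hA hB; exact: (@measurableI _ (g_sigma_algebraType _) A B hA hB).
    have sDc : family_sigma X (window t n n.+1) (~` D n) by rewrite -setTD; exact: sCn.
    have prI C E : family_sigma X (window t 0 n) C -> family_sigma X (window t n n.+1) E ->
        pr P (C `&` E) = pr P C * pr P E.
      move=> hC hE; apply: prI_indep.
      - exact: (family_sigma_measurable mX hC).
      - exact: (family_sigma_measurable mX hE).
      - by apply: (iid_indep iidX _ hC hE); exact: window_disjoint.
    move=> C; rewrite mem_cat => /orP[] /mapP[C' C'L ->]; have [h1 h2] := hL _ C'L; split.
    - by apply: sI; [exact: sub1|exact: sub2].
    - rewrite prI// exprSr ler_pM ?pr_ge0// pD le_max lexx//.
    - by apply: sI; [exact: sub1|exact: sub2].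
    - rewrite prI// exprSr ler_pM ?pr_ge0// prC// pD le_max lexx orbT//.
  rewrite big_cat/= !big_map; apply/seteqP; split => // w _.
  have : (\big[setU/set0]_(C <- L) C) w by rewrite cov.
  rewrite -bigcup_seq => -[C /= CL Cw].
  have [Dw|Dw] := pselect (D n w); [left|right]; rewrite -bigcup_seq; by exists C.
have : \forall n \near \oo, r ^+ n < e.
  have rc : (fun n => r ^+ n) @ \oo --> (0 : R) by apply: cvg_expr; rewrite ger0_norm.
  exact: (cvgr_lt _ rc).
case=> n _ hn; have [L [hL cov]] := key n; exists n, L; split => // C CL.
have [h1 h2] := hL C CL; split => //; apply: le_trans h2 (ltW _).
exact: (hn n (leqnn n)).
Unshelve. all: by end_near. Qed.

End exact_events.

(** * Passing between completed and exact pasts *)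

Section completed_pasts.
Context {R : realType} {d : measure_display} {T : measurableType d}.
Variable P : probability T R.

Lemma measurable_wrt_series (G : set (set T)) (c : nat -> R) (Z : nat -> T -> R) n :
  (forall j, measurable_wrt G (Z j)) ->
  measurable_wrt G (fun w => series (fun j => c j * Z j w) n).
Proof.
move=> mZ; apply: measurable_sum => j; apply: measurable_funM; first exact: measurable_cst.
exact: mZ.
Qed.

Lemma measurable_completion_sigma (F : set (set T)) : sigma_algebra setT F ->
  sigma_algebra setT [set A | measurable A /\ null_completion P F A].
Proof.
move=> /(null_completion_sigma P)[c0 cC cU]; split.
- by split; [exact: measurable0|exact: c0].
- by move=> A [mA cA]; split; [exact: measurableD|exact: cC].
- move=> A hA; split; first by apply: bigcupT_measurable => n; have [] := hA n.
  by apply: cU => n; have [] := hA n.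
Qed.

(** Returns an event built in the completion to the sigma-algebra itself, at the price of almost
    sure inclusion. *)
Lemma completion_event (F : set (set T)) A : F `<=` measurable -> measurable A ->
  null_completion P F A ->
  exists A', [/\ F A', pr P A' = pr P A & {ae P, forall w, A w -> A' w}].
Proof.
move=> Fm mA [A' FA' nA]; exists A'; split => //.
  rewrite /pr; congr fine; apply/esym/negligible_measure_eq => //; exact: Fm.
apply: negligibleS nA => w /= h; left; apply: contrapT => h2; apply: h => Aw.
by apply: contrapT => nA'w; apply: h2.
Qed.

End completed_pasts.

Lemma eta_plus_shift_le (R : realType) (pe alpha : R) (a : nat -> R) (h : nat) :
  0 <= pe <= 1 -> C_alpha alpha a -> eta_plus pe alpha a h <= eta_plus pe alpha a 0.
Proof.
move=> pe01 Ca; rewrite /eta_plus.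
pose u j := kappa_plus pe (a j) * `|a j| `^ alpha.
have u0 j : 0 <= u j.
  by have /andP[k0 _] := kappa_plus_ge0 (a j) pe01; rewrite mulr_ge0 ?powR_ge0.
have -> : (fun j => kappa_plus pe (a (j + 0)%N) * `|a (j + 0)%N| `^ alpha) = u.
  by apply/funext => j; rewrite addn0.
have ul : series u @ \oo --> limn (series u) := kappa_series_cvg pe01 Ca.
apply: limr_le; first exact: (kappa_series_cvg pe01 (C_alpha_shift h Ca)).
apply: nearW => n; apply: le_trans (series_partial_le u0 ul (n + h)%N).
have -> : series (fun j => kappa_plus pe (a (j + h)%N) * `|a (j + h)%N| `^ alpha) n =
    series u (n + h)%N - series u h.
  by rewrite -series_shift.
by rewrite gerBl; apply: sumr_ge0.
Qed.

Theorem theorem7 (R : realType) (d : measure_display) (T : measurableType d)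
  (P : probability T R) (eps : int -> T -> R) (alpha pe : R) (a : nat -> R)
  (Y : int -> T -> R) (Yopt : T -> R) (t : int) (h : nat) :
  iid P eps ->
  (forall s, regularly_varying_rv P (eps s) alpha pe) ->
  (1 < alpha -> forall s, ('E_P[eps s] = 0)%E) ->
  C_alpha alpha a ->
  (forall s, measurable_fun setT (Y s)) ->
  (forall s, {ae P, forall w,
      series (fun j => a j * eps (s - j%:Z) w) @ \oo --> Y s w}) ->
  (exists b : nat -> R, forall s, {ae P, forall w,
      series (fun j => b j * Y (s - j%:Z) w) @ \oo --> eps s w}) ->
  (1 <= h)%N ->
  0 < eta_plus pe alpha a h ->
  measurable_fun setT Yopt ->
  {ae P, forall w,
      series (fun j => a (j + h)%N * eps (t - j%:Z) w) @ \oo --> Yopt w} ->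
  tail_dep_coeff_is P (Y (t + h%:Z)) Yopt
    (eta_plus pe alpha a h / eta_plus pe alpha a 0) /\
  extremal_optimal_precision_is P Y t (Y (t + h%:Z))
    (eta_plus pe alpha a h / eta_plus pe alpha a 0).
Proof.
move=> iidX rvX EX Ca mY aY [b bY] h1 eta0 mO aO.
have mX := iidX.1; have [al0 [pe01 [rvf _]]] := rvX 0%R.
pose past_t := [set s : int | s <= t].
pose E := family_sigma eps past_t; pose F := family_sigma Y past_t.
have sE : sigma_algebra setT E := family_sigma_algebra eps past_t.
have sF : sigma_algebra setT F := family_sigma_algebra Y past_t.
have Em : E `<=` measurable by exact: family_sigma_measurable.
have Fm : F `<=` measurable by exact: family_sigma_measurable.
have le_t (s : int) (j : nat) : s <= t -> past_t (s - j%:Z).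
  by move=> st; rewrite /past_t/= lerBlDr (le_trans st)// lerDl.
have sEc := null_completion_sigma P sE; have sFc := null_completion_sigma P sF.
have subE G : sigma_algebra setT G -> forall W, measurable_wrt G W ->
    measurable_wrt (null_completion P G) W.
  move=> sG W; apply: measurable_wrt_sub => //; first exact: null_completion_sigma.
  exact: sub_null_completion.
(* Invertibility puts the innovations in the completed past of [Y]; [YE] below is the converse, from
   causality. *)
have XF s : s <= t -> measurable_wrt (null_completion P F) (eps s).
  move=> st; apply: (null_completion_cvg sF _ (bY s)) => n.
  apply: (@measurable_wrt_series _ _ _ _ b (fun j => Y (s - j%:Z))) => j.
  by apply: subE => //; apply: measurable_wrt_family => //; exact: le_t.
have YE s : s <= t -> measurable_wrt (null_completion P E) (Y s).
  move=> st; apply: (null_completion_cvg sE _ (aY s)) => n.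
  apply: (@measurable_wrt_series _ _ _ _ a (fun j => eps (s - j%:Z))) => j.
  by apply: subE => //; apply: measurable_wrt_family => //; exact: le_t.
have OF : measurable_wrt (null_completion P F) Yopt.
  apply: (null_completion_cvg sF _ aO) => n.
  apply: (@measurable_wrt_series _ _ _ _ (fun j => a (j + h)%N) (fun j => eps (t - j%:Z))) => j.
  by apply: XF; exact: le_t.
have OE : measurable_wrt (null_completion P E) Yopt.
  apply: (null_completion_cvg sE _ aO) => n.
  apply: (@measurable_wrt_series _ _ _ _ (fun j => a (j + h)%N) (fun j => eps (t - j%:Z))) => j.
  by apply: subE => //; apply: measurable_wrt_family => //; exact: le_t.
(* One sigma-algebra that contains the past of [Y] and the events of [Yopt] and is still independent
   of [Z]. *)
pose past := [set A | measurable A /\ null_completion P E A].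
have past_alg : sigma_algebra setT past := measurable_completion_sigma P sE.
have pastF : F `<=` past.
  apply: smallest_sub => // _ [s [A [st [mA ->]]]]; split.
    by rewrite -[X in measurable X]setTI; exact: mY.
  by have /(measurable_wrtP _ sEc) := YE s st; apply.
pose V := Y (t + h%:Z).
pose Z w := \sum_(0 <= j < h) a j * eps (t + h%:Z - j%:Z) w.
have ZW := @measurable_wrt_window_sum _ _ _ eps a (t + h%:Z) 0 h mX.
have mZ : measurable_fun setT Z := measurable_window_sum (t + h%:Z) iidX a 0 h.
have VE : {ae P, forall w, V w = Z w + Yopt w}.
  apply: filterS2 (aY (t + h%:Z)) aO => w cV cO.
  set u := fun j => a j * eps (t + h%:Z - j%:Z) w in cV.
  have cs : (fun n => series u (n + h)%N) @ \oo --> V w.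
    by apply: cvg_comp cV; exact: cvg_addnr.
  have e : (fun n => series u (n + h)%N) =
      (fun n => Z w + series (fun j => a (j + h)%N * eps (t - j%:Z) w) n).
    apply/funext => n; apply/eqP; rewrite addrC -subr_eq.
    rewrite -[_ - Z w]/(series u (n + h)%N - series u h) -series_shift.
    apply/eqP/eq_bigr => j _; rewrite /u; congr (_ * eps _ w).
    by rewrite PoszD opprD addrACA subrr addr0.
  rewrite e in cs; apply: (cvg_unique _ cs) => //.
  by apply: cvgD => //; exact: cvg_cst.
have Uc := linear_process_tail iidX rvX EX (C_alpha_shift h Ca) mO aO.
(* The shift by 0 is kept because [eta_plus] at 0 unfolds to coefficients [a (j + 0)]. *)
have aY0 : {ae P, forall w,
    series (fun j => a (j + 0)%N * eps (t + h%:Z - j%:Z) w) @ \oo --> V w}.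
  apply: filterS (aY (t + h%:Z)) => w.
  have -> // : (fun j => a (j + 0)%N * eps (t + h%:Z - j%:Z) w) =
      (fun j => a j * eps (t + h%:Z - j%:Z) w).
  by apply/funext => j; rewrite addn0.
have Vc := linear_process_tail iidX rvX EX (C_alpha_shift 0 Ca) (mY (t + h%:Z)) aY0.
have cUV := eta_plus_shift_le h pe01 Ca.
have pastm : past `<=` measurable by move=> A [].
have past_indep A (B : set R) : past A -> measurable B ->
    P (A `&` Z @^-1` B) = (P A * P (Z @^-1` B))%E.
  move=> [mA cA] mB; have [A' [EA' -> AB]] := null_completion_measure_eq Em mA cA.
  have mZB : measurable (Z @^-1` B) by rewrite -[X in measurable X]setTI; exact: mZ.
  rewrite AB//; have /(measurable_wrtP _ (family_sigma_algebra eps _)) hZ := ZW.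
  apply: (iid_indep iidX _ EA' (hZ B mB)).
  (* [Z] uses only the innovations at times [t + h - j] with [j < h], all later than [t]. *)
  apply/seteqP; split => // s [/= st [j /andP[_ jh] sj]]; move: st.
  rewrite /past_t/= sj leNgt => /negP; apply.
  by rewrite -addrA ltrDl subr_gt0 ltz_nat.
have pastO (B : set R) : measurable B -> past (Yopt @^-1` B).
  move=> mB; split; first by rewrite -[X in measurable X]setTI; exact: mO.
  by move/(measurable_wrtP _ sEc) : OE; apply.
split.
  exact: (tail_dep_of_predictor (mY _) mO mZ VE rvf Uc Vc al0 eta0 cUV pastm past_indep pastO).
apply: (optimal_precision_of_predictor (mY _) mO mZ VE rvf Uc Vc al0 eta0 cUV pastm past_indep
  pastO pastF) => y v Uv v1.
(* The filling takes place in the completed past of [Y], which contains both [Yopt > y] and the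
   cells cut out by the innovations. *)
pose H := [set A | measurable A /\ null_completion P F A].
have sH : sigma_algebra setT H := measurable_completion_sigma P sF.
have HB : H [set w | y < Yopt w].
  split; first exact: measurable_gt.
  rewrite (_ : [set _ | _] = Yopt @^-1` `]y, +oo[); last first.
    by apply/seteqP; split => w /=; rewrite in_itv/= andbT.
  by move/(measurable_wrtP _ sFc) : OF; apply; exact: measurable_itv.
have Hm : H `<=` measurable by move=> A [].
have HUU (A : nat -> set T) : (forall n, H (A n)) -> H (\bigcup_n A n) by case: sH => _ _; apply.
have HU A C : H A -> H C -> H (A `|` C).
  move=> HA HC; rewrite -bigcup2E; apply: HUU => -[|[|n]] //=.
  by case: sH.
have HL e : 0 < e -> exists L : seq (set T),
    (forall C, C \in L -> H C /\ pr P C <= e) /\ \big[setU/set0]_(C <- L) C = setT.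
  move=> e0; have [n [L [hL cov]]] := iid_partition t iidX rvX e0.
  exists L; split => // C CL; have [h2 h3] := hL C CL; split => //.
  apply: (smallest_sub sH _ h2) => _ [s [A [[j _ ->] [mA ->]]]]; split.
    by rewrite -[X in measurable X]setTI; exact: mX.
  have /(measurable_wrtP _ sFc) := XF (t - j%:Z) (le_t t j (lexx t)).
  by apply.
have [A [[mA cA] BA pA]] := exists_event_pr Hm HU HUU HL HB Uv v1.
have [A' [FA' pA' AA']] := completion_event Fm mA cA.
exists A'; split => //; first by rewrite pA'.
by apply: filterS AA' => w h2 yw; exact/h2/BA.
Qed.
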